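(* Let $0<n\in\mathbb{N}$, $\tau\in(0,1)$, $2\le s\in\mathbb{N}$ and $p=2^s$. Suppose that $\gamma>1$ satisfies $\overline g_{k-1,k}(x)\le\gamma$ for all $x\in E$ and $1\le k\le n$. Suppose that there are positive constants $a_k^*,b_k^*$ ($1\le k\le n$) such that for all $1\le k\le n$ and $f\in B(E)$ $$\|K_k^{t_k}(f)\|_{L_{q(p',t_k)}(\mu_k)}\le\|f\|_{L_{p'}(\mu_k)}\quad\text{for all }p'>1,\ \text{ where } q(p',t_k)=1+(p'-1)\exp(2a_k^*t_k),$$ and $$\|K_k^{t_k}(f)-\mu_k(f)\|_{L_2(\mu_k)}^2\le\exp(-2b_k^*t_k)\,\|f-\mu_k(f)\|_{L_2(\mu_k)}^2 .$$ Assume that for $1\le l\le n$ $$t_l\ge\frac{1}{2b_l^*}\big[(2p-1)\log(\gamma)-\log(1-\tau)\big]\quad\text{and}\quad t_l\ge\frac{1}{2a_l^*}\Big[\log(p-1)-\log\Big(\frac p2-1\Big)\Big].$$ Then for all $f\in B(E)$ $$N\,\mathbb{E}[|\nu_n^N(f)-\mu_n(f)|^2]\le\|f\|_{L_p(\mu_n)}^2\Big[1+n\gamma\tau^{-2}+n\,((1+\gamma)\vee3)\,\gamma^{2s+p^{-1}}\tau^{-2}\,\overline\varepsilon_n^{N,p}\Big],$$ where $$\overline\varepsilon_n^{N,p}=\max_{0\le j\le n}\sup\big\{\mathbb{E}[|\nu_j^N(f)-\mu_j(f)|^2]\ \big|\ f\in B(E),\ \|f\|_{L_p(\mu_j)}\le1\big\}.$$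 If in addition $N\ge2\,((1+\gamma)\vee3)\,n\,\gamma^{2s+p^{-1}}\tau^{-2}$, then $$\overline\varepsilon_n^{N,p}\le2\,\frac{1+n\gamma\tau^{-2}}{N}.$$
   Context: $E$ is a Polish space, $B(E)$ the bounded measurable real functions on $E$, $\mu(f)=\int f\,d\mu$, $\|f\|_{L_p(\mu)}=\mu(|f|^p)^{1/p}$, $K(f)(x)=\int f(z)K(x,dz)$ for a kernel $K$, and $a\vee b=\max(a,b)$. $\mu_0,\dots,\mu_n$ are probability measures on $E$; for $1\le k\le n$, $K_k^{t_k}$ is a Markov transition kernel on $E$ with stationary distribution $\mu_k$, where the parameter $t_k>0$ is the running time (number of MCMC steps) of the kernel; $g_{k-1,k}\in B(E)$ is positive with $\mu_k(f)=\mu_{k-1}(g_{k-1,k}f)/\mu_{k-1}(g_{k-1,k})$ for all $f\in B(E)$. Put $\overline g_{k-1,k}=g_{k-1,k}/\mu_{k-1}(g_{k-1,k})$ and $q_{k-1,k}(f)=\overline g_{k-1,k}K_k^{t_k}(f)$; in particular $q_{k-1,k}(1)=\overline g_{k-1,k}$. Particle system with $N\geq 1$ particles: $\xi_0^1,\dots,\xi_0^N$ are i.i.d. from $\mu_0$. For $k=1,\dots,n$: given the past up to $\xi_{k-1}$, the variables $\hat\xi_k^1,\dots,\hat\xi_k^N$ are conditionally i.i.d. with law $\sum_{i=1}^N \frac{g_{k-1,k}(\xi_{k-1}^i)}{\sum_{l=1}^N g_{k-1,k}(\xi_{k-1}^l)}\delta_{\xi_{k-1}^i}$; given the past up to $\hat\xi_k$,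 the variables $\xi_k^1,\dots,\xi_k^N$ are conditionally independent with $\xi_k^j\sim K_k^{t_k}(\hat\xi_k^j,\cdot)$. $\mathbb{E}$ is expectation with respect to the particle system. $\eta_k^N=\frac1N\sum_{i=1}^N\delta_{\xi_k^i}$, and $\nu_k^N(f)=\varphi_k\,\eta_k^N(f)$ with $\varphi_0=1$ and $\varphi_k=\prod_{j=0}^{k-1}\eta_j^N(q_{j,j+1}(1))$ for $k\ge1$. *)

(* Defs.v *)
From HB Require Import structures.
From mathcomp Require Import all_boot all_order all_algebra.
From mathcomp Require Import all_classical all_reals all_analysis.

Set Implicit Arguments.
Unset Strict Implicit.
Unset Printing Implicit Defensive.
Import Order.TTheory GRing.Theory Num.Theory.
Import numFieldNormedType.Exports.

Local Open Scope classical_set_scope.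
Local Open Scope ring_scope.

Definition polish (R : realType) (E : ptopologicalType) : Prop :=
  (exists2 D : set E, countable D & dense D) /\
  exists dist : E -> E -> R,
    [/\ forall x y, dist x y = 0 <-> x = y,
        forall x y, dist x y = dist y x,
        forall x y z, dist x z <= dist x y + dist y z,
        forall A : set E, open A <->
          forall x, A x -> exists2 e : R, 0 < e & [set y | dist x y < e] `<=` A
      & forall u : nat -> E,
          (forall e : R, 0 < e -> exists m, forall i j,
             (m <= i)%N -> (m <= j)%N -> dist (u i) (u j) < e) ->
          exists l : E, u @ \oo --> l].

Notation borel T := (g_sigma_algebraType (@open T)).

(* B(E) *)
Definition bounded_measurable {R : realType} {d} {E : measurableType d}
    (f : E -> R) : Prop :=
  measurable_fun [set: E] f /\ exists M : R, forall x, `|f x| <= M.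

Definition stationary {R : realType} {d} {E : measurableType d}
    (m : probability E R) (K : R.-pker E ~> E) : Prop :=
  forall A : set E, measurable A -> (\int[m]_x K x A = m A)%E.

(* K(f)(x) *)
Definition kernel_apply {R : realType} {d} {E : measurableType d}
    (K : R.-pker E ~> E) (f : E -> R) (x : E) : R := \int[K x]_z f z.

Section particle_system.
Context {R : realType} {d} {E : measurableType d}.
(* g k stands for g_{k-1,k}, and K k u for the kernel K_k^u run for time u;
   only the indices 1 <= k <= n matter. *)
Context (mu : nat -> probability E R) (g : nat -> E -> R)
  (K : nat -> R -> R.-pker E ~> E) (t : nat -> R).

(* normalised weight, for g_{k-1,k} *)
Definition gbar (k : nat) (x : E) : R := g k x / \int[mu k.-1]_y g k y.

(* q k stands for q_{k-1,k} *)
Definition q (k : nat) (f : E -> R) (x : E) : R :=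
  gbar k x * kernel_apply (K k (t k)) f x.

Context {N : nat} {dO} {Omega : measurableType dO}.
Context (P : probability Omega R) (xi xihat : nat -> 'I_N -> Omega -> E).

(* The sigma-algebra generated by the xi_j with j < k and by the xihat_j with
   1 <= j < l. *)
Definition past (k l : nat) : set (set Omega) :=
  <<s [set A | exists j i B, measurable B /\
        ((j < k)%N /\ A = xi j i @^-1` B \/
         (0 < j < l)%N /\ A = xihat j i @^-1` B)] >>.

(* Given the sigma-algebra G, the X i are conditionally independent, and
   L i w is the conditional law of X i at w. *)
Definition cond_indep_laws (G : set (set Omega)) (X : 'I_N -> Omega -> E)
    (L : 'I_N -> Omega -> set E -> \bar R) : Prop :=
  forall (A : set Omega) (B : 'I_N -> set E), G A ->
    (forall i, measurable (B i)) ->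
    (P (A `&` \bigcap_i (X i @^-1` B i)) =
     \int[P]_(w in A) \prod_(i < N) L i w (B i))%E.

Definition resampling_law (h : E -> R) (x : 'I_N -> E) (A : set E) : \bar R :=
  (\sum_(i < N) (h (x i) / \sum_(l < N) h (x l))%:E * \d_(x i) A)%E.

Record is_particle_system (n : nat) : Prop := {
  xi_measurable : forall k i, (k <= n)%N -> measurable_fun [set: Omega] (xi k i);
  xihat_measurable : forall k i, (1 <= k <= n)%N ->
    measurable_fun [set: Omega] (xihat k i);
  xi_initial : forall B : 'I_N -> set E, (forall i, measurable (B i)) ->
    (P (\bigcap_i (xi 0%N i @^-1` B i)) = \prod_(i < N) mu 0%N (B i))%E;
  xihat_selection : forall k, (1 <= k <= n)%N ->
    cond_indep_laws (past k k) (xihat k)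
      (fun _ w => resampling_law (g k) (fun i => xi k.-1 i w));
  xi_mutation : forall k, (1 <= k <= n)%N ->
    cond_indep_laws (past k k.+1) (xi k)
      (fun j w => K k (t k) (xihat k j w))
}.

Definition eta (k : nat) (f : E -> R) (w : Omega) : R :=
  N%:R^-1 * \sum_(i < N) f (xi k i w).

Definition phi (k : nat) (w : Omega) : R :=
  \prod_(j < k) eta j (q j.+1 (cst 1)) w.

Definition nu (k : nat) (f : E -> R) (w : Omega) : R := phi k w * eta k f w.

Definition mse (k : nat) (f : E -> R) : \bar R :=
  'E_P[(fun w => `|nu k f w - \int[mu k]_x f x| ^+ 2)%R]%E.

(* The suprema are taken in the extended reals, so that no finiteness is
   presupposed. *)
Definition eps_bar (n : nat) (p : R) : \bar R :=
  \big[maxe/-oo%E]_(j < n.+1)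
    ereal_sup [set mse j f | f in
      [set f | bounded_measurable f /\
               ('N[mu j]_p%:E[EFin \o f] <= 1)%E]].

End particle_system.

(* Main.v *)
(* Every function in sight is bounded and measurable: all integrals are finite.
   Given the past, the particles at time k are i.i.d. with law a reweighted
   empirical measure moved by K_k, and therefore
     N E[nu_k(f)^2] = E[nu_{k-1}(q_k 1) nu_{k-1}(q_k(f^2))]
                      + (N - 1) E[nu_{k-1}(q_k f)^2],   E[nu_k(f)] = mu_k(f).
   This bounds N Var(nu_k(f)) by N Var(nu_{k-1}(q_k f)) plus mu_k(f^2) plus a
   covariance, which Cauchy-Schwarz controls by eps_bar times the L_p norms of
   q_k 1 and q_k(f^2); by hypercontractivity the latter is of the order of
   ||f||_p^2.  The recursion closes because the maps q_k are stable in the norms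
   L_{2^r}, r <= s: the spectral gap gives
     mu_{k-1}((q_k f)^(2^(r+1)))
       <= gamma^(2^(r+1)-1)
          (exp(-2 b t) mu_k(f^(2^(r+1))) + mu_k(f^(2^r))^2),
   and the running time makes the first coefficient at most 1 - tau.  Finally
   eps_bar is finite because mse_k(f) <= gamma^k mu_k(f^2), so in the second
   claim it can be absorbed into the left-hand side. *)

Require Import Defs.
From HB Require Import structures.
From mathcomp Require Import all_boot all_order all_algebra.
From mathcomp Require Import all_classical all_reals all_analysis.
From mathcomp Require Import measurable_realfun zify ring lra.

Set Implicit Arguments.
Unset Strict Implicit.
Unset Printing Implicit Defensive.
Import Order.TTheory GRing.Theory Num.Theory.
Import numFieldNormedType.Exports.

Local Open Scope classical_set_scope.
Local Open Scope ring_scope.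

(** * Means of bounded measurable functions *)

Section bounded_measurable_closure.
Context {R : realType} {d} {T : measurableType d}.
Implicit Types f g : T -> R.

Lemma bounded_measurable_cst (c : R) :
  bounded_measurable ((fun=> c) : T -> R).
Proof. by split; [exact: measurable_cst|exists `|c|]. Qed.

Lemma bounded_measurableD f g : bounded_measurable f -> bounded_measurable g ->
  bounded_measurable (fun x => f x + g x).
Proof.
move=> [mf [M fM]] [mg [M' gM]]; split; first exact: measurable_funD.
by exists (M + M') => x; rewrite (le_trans (ler_normD _ _))// lerD.
Qed.

Lemma bounded_measurableM f g : bounded_measurable f -> bounded_measurable g ->
  bounded_measurable (fun x => f x * g x).
Proof.
move=> [mf [M fM]] [mg [M' gM]]; split; first exact: measurable_funM.
by exists (M * M') => x; rewrite normrM ler_pM.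
Qed.

Lemma bounded_measurableZ (c : R) f : bounded_measurable f ->
  bounded_measurable (fun x => c * f x).
Proof. exact/bounded_measurableM/bounded_measurable_cst. Qed.

Lemma bounded_measurableB f g : bounded_measurable f -> bounded_measurable g ->
  bounded_measurable (fun x => f x - g x).
Proof.
move=> [mf [M fM]] [mg [M' gM]]; split; first exact: measurable_funB.
by exists (M + M') => x; rewrite (le_trans (ler_normB _ _))// lerD.
Qed.

Lemma bounded_measurableX n f : bounded_measurable f ->
  bounded_measurable (fun x => f x ^+ n).
Proof.
move=> [mf [M fM]]; split; first exact: measurable_funX.
by exists (M ^+ n) => x; rewrite normrX lerXn2r// nnegrE// (le_trans _ (fM x)).
Qed.

Lemma bounded_measurable_sum (I : Type) (r : seq I) (F : I -> T -> R) :
  (forall i, bounded_measurable (F i)) ->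
  bounded_measurable (fun x => \sum_(i <- r) F i x).
Proof.
move=> bF; elim: r => [|i r IH].
  by under eq_fun do rewrite big_nil; exact: bounded_measurable_cst.
by under eq_fun do rewrite big_cons; exact: bounded_measurableD.
Qed.

Lemma bounded_measurable_prod (I : Type) (r : seq I) (p : pred I)
    (F : I -> T -> R) : (forall i, bounded_measurable (F i)) ->
  bounded_measurable (fun x => \prod_(i <- r | p i) F i x).
Proof.
move=> bF; elim: r => [|i r IH].
  by under eq_fun do rewrite big_nil; exact: bounded_measurable_cst.
under eq_fun do rewrite big_cons; case: (p i) => //.
exact: bounded_measurableM.
Qed.

Lemma bounded_measurable_indic (A : set T) : measurable A ->
  bounded_measurable (\1_A : T -> R).
Proof.
move=> mA; split; first exact: measurable_indic.
by exists 1 => x; rewrite indicE ger0_norm// lern1 leq_b1.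
Qed.

Lemma bounded_measurable_comp d' (U : measurableType d') (X : U -> T) f :
  measurable_fun [set: U] X -> bounded_measurable f ->
  bounded_measurable (fun u => f (X u)).
Proof.
by move=> mX [mf [M fM]]; split; [exact: measurableT_comp|exists M].
Qed.

Lemma bounded_measurable_integrable (mu : probability T R) f :
  bounded_measurable f -> mu.-integrable [set: T] (EFin \o f).
Proof.
move=> [mf [M fM]]; apply: measurable_bounded_integrable => //.
  exact: le_lt_trans (probability_le1 mu measurableT) (ltry _).
exists M; split=> [|y My x _ /=]; first exact: num_real.
exact: le_trans (fM x) (ltW My).
Qed.

End bounded_measurable_closure.

Ltac bounded_measurability := repeat first
  [ assumption | exact: bounded_measurable_cst | apply: bounded_measurableZ
  | apply: bounded_measurableX | apply: bounded_measurableB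
  | apply: bounded_measurableD | apply: bounded_measurableM ].

Section mean.
Context {R : realType} {d} {T : measurableType d} (mu : probability T R).
Implicit Types f g : T -> R.

Lemma meanD f g : bounded_measurable f -> bounded_measurable g ->
  \int[mu]_x (f x + g x) = \int[mu]_x f x + \int[mu]_x g x.
Proof.
by move=> bf bg; rewrite RintegralD//; exact: bounded_measurable_integrable.
Qed.

Lemma meanB f g : bounded_measurable f -> bounded_measurable g ->
  \int[mu]_x (f x - g x) = \int[mu]_x f x - \int[mu]_x g x.
Proof.
by move=> bf bg; rewrite RintegralB//; exact: bounded_measurable_integrable.
Qed.

Lemma meanZ c f : bounded_measurable f ->
  \int[mu]_x (c * f x) = c * \int[mu]_x f x.
Proof.
by move=> bf; rewrite RintegralZl//; exact: bounded_measurable_integrable.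
Qed.

Lemma mean_cst (c : R) : \int[mu]_x c = c.
Proof.
rewrite Rintegral_cst// [X in fine X](_ : _ = 1%E) ?mulr1//.
exact: probability_setT.
Qed.

Lemma mean_sum (I : Type) (r : seq I) (F : I -> T -> R) :
  (forall i, bounded_measurable (F i)) ->
  \int[mu]_x (\sum_(i <- r) F i x) = \sum_(i <- r) \int[mu]_x F i x.
Proof.
move=> bF; elim: r => [|i r IH].
  by under eq_Rintegral do rewrite big_nil; rewrite mean_cst big_nil.
under eq_Rintegral do rewrite big_cons.
by rewrite big_cons meanD// ?IH//; exact: bounded_measurable_sum.
Qed.

Lemma le_mean f g : bounded_measurable f -> bounded_measurable g ->
  (forall x, f x <= g x) -> \int[mu]_x f x <= \int[mu]_x g x.
Proof.
by move=> bf bg fg; apply: le_Rintegral => //;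
  exact: bounded_measurable_integrable.
Qed.

Lemma mean_ge0 f : (forall x, 0 <= f x) -> 0 <= \int[mu]_x f x.
Proof. by move=> f0; exact: Rintegral_ge0. Qed.

Lemma mean_indic (A : set T) : measurable A -> \int[mu]_x \1_A x = fine (mu A).
Proof. by move=> mA; rewrite /Rintegral integral_indic// setIT. Qed.

Lemma EFin_mean f : bounded_measurable f ->
  (\int[mu]_x (f x)%:E = (\int[mu]_x f x)%:E)%E.
Proof.
move=> bf; rewrite /Rintegral fineK//.
exact/integrable_fin_num/bounded_measurable_integrable.
Qed.

Lemma norm_mean_le f M : bounded_measurable f -> (forall x, `|f x| <= M) ->
  `|\int[mu]_x f x| <= M.
Proof.
move=> bf fM; rewrite ler_norml; apply/andP; split.
  rewrite -[leLHS]mean_cst; apply: le_mean => //.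
    exact: bounded_measurable_cst.
  by move=> x; have := fM x; rewrite ler_norml => /andP[].
rewrite -[leRHS]mean_cst; apply: le_mean => //.
  exact: bounded_measurable_cst.
by move=> x; have := fM x; rewrite ler_norml => /andP[].
Qed.

Lemma variance_mean f : bounded_measurable f ->
  \int[mu]_x ((f x - \int[mu]_y f y) ^+ 2) =
  \int[mu]_x (f x ^+ 2) - (\int[mu]_x f x) ^+ 2.
Proof.
move=> bf; set m := \int[mu]_y f y.
have b2 := bounded_measurableX 2 bf.
have bm := bounded_measurableZ (2 * m) bf.
have -> : \int[mu]_x ((f x - m) ^+ 2) =
    \int[mu]_x ((f x ^+ 2 - (2 * m) * f x) + m ^+ 2).
  by apply: eq_Rintegral => x _; ring.
rewrite meanD ?meanB ?meanZ ?mean_cst -/m; first by ring.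
all: bounded_measurability.
Qed.

Lemma sqr_mean_le f : bounded_measurable f ->
  (\int[mu]_x f x) ^+ 2 <= \int[mu]_x (f x ^+ 2).
Proof.
move=> bf; rewrite -subr_ge0 -variance_mean//.
by apply: mean_ge0 => x; exact: sqr_ge0.
Qed.

(* The quadratic [u |-> mu((u f + g)^2)] is nonnegative. *)
Lemma Cauchy_Schwarz_mean f g : bounded_measurable f -> bounded_measurable g ->
  (\int[mu]_x (f x * g x)) ^+ 2 <=
  \int[mu]_x (f x ^+ 2) * \int[mu]_x (g x ^+ 2).
Proof.
move=> bf bg; set a := \int[mu]_x (f x ^+ 2); set c := \int[mu]_x (g x ^+ 2).
set b := \int[mu]_x (f x * g x).
have bfg := bounded_measurableM bf bg.
have bf2 := bounded_measurableX 2 bf.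
have bg2 := bounded_measurableX 2 bg.
have H u v : 0 <= u ^+ 2 * a + 2 * (u * v) * b + v ^+ 2 * c.
  have -> : u ^+ 2 * a + 2 * (u * v) * b + v ^+ 2 * c =
      \int[mu]_x ((u * f x + v * g x) ^+ 2).
    rewrite -!meanZ// -!meanD//; first by apply: eq_Rintegral => x _; ring.
    all: bounded_measurability.
  by apply: mean_ge0 => x; exact: sqr_ge0.
have a0 : 0 <= a by apply: mean_ge0 => x; exact: sqr_ge0.
have [a_gt0|] := ltP 0 a.
  have := H (- b) a; rewrite (_ : _ + _ = a * (a * c - b ^+ 2)); last by ring.
  by rewrite pmulr_rge0// subr_ge0.
move=> a_le0; have {a_le0} a00 : a = 0 by apply/eqP; rewrite eq_le a_le0.
rewrite a00 mul0r; suff -> : b = 0 by rewrite expr0n.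
apply/eqP/negPn/negP => b0.
(* With [a = 0] this choice of [u] makes the quadratic equal to [-1]. *)
have := H (- (c + 1) / (2 * b)) 1; rewrite a00.
rewrite (_ : _ + _ = -1); last by field.
by rewrite oppr_ge0 ler10.
Qed.

End mean.

(* Peeling off [M/2] times the indicator of [f >= M/2] halves the sup norm of a
   nonnegative [f] without changing [D f]. *)
Lemma functional_eq0 {R : realType} {d} {T : measurableType d}
    (D : (T -> R) -> R) (C : R) :
  (forall f g, bounded_measurable f -> bounded_measurable g ->
     D (fun x => f x + g x) = D f + D g) ->
  (forall c f, bounded_measurable f -> D (fun x => c * f x) = c * D f) ->
  (forall f M, bounded_measurable f -> (forall x, `|f x| <= M) ->
     `|D f| <= C * M) ->
  (forall A, measurable A -> D \1_A = 0) ->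
  forall f, bounded_measurable f -> D f = 0.
Proof.
move=> DD DZ DC D1.
have halving m : forall M f, bounded_measurable f ->
    (forall x, 0 <= f x <= M) -> `|D f| <= C * (M / 2 ^+ m).
  elim: m => [|m IH] M f bf fM.
    rewrite expr0 divr1; apply: DC => // x.
    by have /andP[? ?] := fM x; rewrite ger0_norm.
  pose A := [set x | M / 2 <= f x].
  have mA : measurable A.
    have := bf.1 measurableT _ (measurable_itv `[M / 2, +oo[).
    rewrite setTI; congr measurable; apply/seteqP; split => x /=;
    by rewrite /A/= in_itv/= andbT.
  have bA := bounded_measurable_indic mA.
  pose f' x := f x + (- (M / 2)) * \1_A x.
  have bf' : bounded_measurable f'.
    exact/bounded_measurableD/bounded_measurableZ.
  have -> : D f = D f'.
    by rewrite DD ?DZ ?D1 ?mulr0 ?addr0//; exact: bounded_measurableZ.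
  have -> : M / 2 ^+ m.+1 = (M / 2) / 2 ^+ m by rewrite exprS invfM mulrA.
  apply: IH => // x; rewrite /f' indicE; have /andP[f0 fm] := fM x.
  have [/set_mem|/negP xA] := boolP (x \in A); rewrite /A/=; first by lra.
  have : ~ A x by move=> /mem_set.
  by rewrite /A/= => /negP; rewrite -ltNge; lra.
have D0 M f : bounded_measurable f -> (forall x, 0 <= f x <= M) -> D f = 0.
  move=> bf fM; apply/eqP; rewrite -normr_le0; apply/ler_addgt0Pl => e e0.
  rewrite addr0; have := @cvg_geometric R (C * M) (2^-1).
  rewrite ger0_norm ?invr_ge0// invf_lt1 ?ltr1n//.
  move=> /(_ isT) /cvgrPdist_lt/(_ _ e0)[m _ /(_ _ (leqnn m))].
  rewrite /= /geometric /= sub0r normrN => h.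
  have := halving m _ _ bf fM; rewrite mulrA -exprVn => /le_trans; apply.
  by rewrite (le_trans (ler_norm _))// ltW.
move=> f bf; have [mf [M fM]] := bf.
(* Adding [M] times the indicator of the whole space makes the function nonnegative and leaves [D f]
   unchanged. *)
pose h x := f x + M; have bh : bounded_measurable h.
  exact/bounded_measurableD/bounded_measurable_cst.
have -> : D f = D h.
  have b1 : bounded_measurable (\1_[set: T] : T -> R).
    exact: bounded_measurable_indic.
  have -> : h = fun x => f x + M * \1_[set: T] x.
    by apply/funext => x; rewrite /h indicT mulr1.
  by rewrite DD ?DZ ?D1 ?mulr0 ?addr0//; exact: bounded_measurableZ.
apply: (D0 (M + M)) => // x; have := fM x; rewrite ler_norml /h => /andP[].
by lra.
Qed.

(** * From conditional laws of events to conditional means *)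

(** [l f w] is to be read as a conditional mean of [f] at [w]. The fields are what the passage from
    indicators to bounded functions needs; kernels, resampling, integration against [mu 0] and the
    identity all satisfy them. *)
Record bounded_operator {R : realType} {dT dE} {T : measurableType dT}
    {E : measurableType dE} (l : (E -> R) -> T -> R) : Prop := {
  operator_bounded_measurable : forall f, bounded_measurable f ->
    bounded_measurable (l f);
  operatorD : forall f g, bounded_measurable f -> bounded_measurable g ->
    l (fun x => f x + g x) = fun w => l f w + l g w;
  operatorZ : forall c f, bounded_measurable f ->
    l (fun x => c * f x) = fun w => c * l f w;
  operator_norm : forall f (M : R), bounded_measurable f ->
    (forall x, `|f x| <= M) -> forall w, `|l f w| <= M
}.

Section operator_extension.
Context {R : realType} {dT dE} {T : measurableType dT} {E : measurableType dE}.
Context (P : probability T R).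

(** The difference of the two sides is linear in [f], bounded by a multiple of the sup norm and zero
    on indicators, so [functional_eq0] applies. *)
Lemma mean_operator_ext (X : T -> E) (l : (E -> R) -> T -> R) (V W : T -> R) :
  measurable_fun [set: T] X -> bounded_operator l ->
  bounded_measurable V -> bounded_measurable W ->
  (forall B, measurable B ->
    \int[P]_w (\1_B (X w) * V w) = \int[P]_w (l \1_B w * W w)) ->
  forall f, bounded_measurable f ->
    \int[P]_w (f (X w) * V w) = \int[P]_w (l f w * W w).
Proof.
move=> mX [lbm lD lZ lN] bV bW VW f bf.
have bX (h : E -> R) : bounded_measurable h -> bounded_measurable (fun w => h (X w)).
  exact: bounded_measurable_comp.
have [_ [MV hMV]] := bV; have [_ [MW hMW]] := bW.
apply/eqP; rewrite -subr_eq0; apply/eqP; move: f bf.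
apply: (@functional_eq0 R _ E _ (MV + MW)) => [f g bf bg|c f bf|f M bf fM|A mA].
- rewrite lD//; have [? ? ? ?] := And4 (bX _ bf) (bX _ bg) (lbm _ bf) (lbm _ bg).
  have -> : \int[P]_w ((f (X w) + g (X w)) * V w) =
      \int[P]_w (f (X w) * V w + g (X w) * V w).
    by apply: eq_Rintegral => w _; ring.
  have -> : \int[P]_w ((l f w + l g w) * W w) =
      \int[P]_w (l f w * W w + l g w * W w).
    by apply: eq_Rintegral => w _; ring.
  by rewrite !meanD; [ring|bounded_measurability..].
- rewrite lZ//; have [? ?] := conj (bX _ bf) (lbm _ bf).
  have -> : \int[P]_w (c * f (X w) * V w) = \int[P]_w (c * (f (X w) * V w)).
    by apply: eq_Rintegral => w _; ring.
  have -> : \int[P]_w (c * l f w * W w) = \int[P]_w (c * (l f w * W w)).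
    by apply: eq_Rintegral => w _; ring.
  by rewrite !meanZ; [ring|bounded_measurability..].
- have [? ?] := conj (bX _ bf) (lbm _ bf).
  rewrite (le_trans (ler_normB _ _))// mulrDl lerD//.
    apply: norm_mean_le; first by bounded_measurability.
    by move=> w; rewrite normrM mulrC ler_pM.
  apply: norm_mean_le; first by bounded_measurability.
  by move=> w; rewrite normrM mulrC ler_pM// lN.
- by rewrite VW// subrr.
Qed.

(** Lifts the product formula of [cond_indep_laws] from events to functions, one coordinate at a
    time. *)
Lemma mean_prod_operator_ext (N : nat) (X : 'I_N -> T -> E)
    (L : 'I_N -> T -> set E -> \bar R) (l : 'I_N -> (E -> R) -> T -> R)
    (A : set T) :
  (forall i, measurable_fun [set: T] (X i)) ->
  (forall i, bounded_operator (l i)) ->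
  (forall i w B, measurable B -> L i w B = (l i \1_B w)%:E) ->
  measurable A ->
  (forall B : 'I_N -> set E, (forall i, measurable (B i)) ->
    (P (A `&` \bigcap_i (X i @^-1` B i)) =
     \int[P]_(w in A) \prod_(i < N) L i w (B i))%E) ->
  forall f : 'I_N -> E -> R, (forall i, bounded_measurable (f i)) ->
    \int[P]_w (\1_A w * \prod_i f i (X i w)) =
    \int[P]_w (\1_A w * \prod_i l i (f i) w).
Proof.
move=> mX bl lL mA PA.
have bA := @bounded_measurable_indic R _ _ _ mA.
(* Only the first [m] coordinates carry arbitrary functions, the others indicators. For [m = 0] this
   is the hypothesis on events. *)
have H m f : (forall i, bounded_measurable (f i)) ->
    (forall i : 'I_N, (m <= i)%N -> exists2 B, measurable B & f i = \1_B) ->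
    \int[P]_w (\1_A w * \prod_i f i (X i w)) =
    \int[P]_w (\1_A w * \prod_i l i (f i) w).
  elim: m f => [|m IH] f bf fB.
    have /choice[B mB] : forall i : 'I_N, exists B, measurable B /\ f i = \1_B.
      by move=> i; have [//|B ? ?] := fB i; exists B.
    have mXB i : measurable (X i @^-1` B i).
      by rewrite -[_ @^-1` _]setTI; apply: mX => //; apply: (mB i).1.
    have mcap : measurable (A `&` \bigcap_i (X i @^-1` B i)).
      apply: measurableI => //; apply: fin_bigcap_measurable => //.
    transitivity (\int[P]_w \1_(A `&` \bigcap_i (X i @^-1` B i)) w : R).
      apply: eq_Rintegral => w _; rewrite indicI /=; congr (_ * _).
      rewrite indicE; case: (boolP (_ \in _)) => [/set_mem h|/negP h].
        rewrite big1// => i _; rewrite (mB i).2 indicE mem_set//.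
        exact: h.
      have /existsNP[i hi] : ~ forall i, (X i @^-1` B i) w.
        by move=> h'; apply: h; apply/mem_set => i _; exact: h'.
      apply/eqP; rewrite prodf_seq_eq0; apply/hasP; exists i.
        by rewrite mem_index_enum.
      by rewrite /= (mB i).2 indicE memNset.
    rewrite mean_indic// PA//; last by move=> i; exact: (mB i).1.
    rewrite [LHS](_ : _ =
        \int[P]_(w in A) (\prod_i l i (f i) w)); last first.
      rewrite /Rintegral; congr fine; apply: eq_integral => w _.
      rewrite -prodEFin; apply: eq_bigr => i _.
      by rewrite lL ?(mB i).2//; exact: (mB i).1.
    rewrite Rintegral_mkcond; apply: eq_Rintegral => w _.
    by rewrite patchE indicE; case: ifP => _; rewrite ?mul1r ?mul0r.
  have [mN|Nm] := ltnP m N; last first.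
    apply: IH => // i mi; have := ltn_ord i.
    by rewrite ltnNge (leq_trans Nm mi).
  pose i0 := Ordinal mN.
  have split_prod (F : 'I_N -> T -> R) :
      \int[P]_w (\1_A w * \prod_i F i w) =
      \int[P]_w (F i0 w * (\1_A w * \prod_(i | i != i0) F i w)).
    by apply: eq_Rintegral => w _; rewrite (bigD1 i0)//=; ring.
  apply: etrans (split_prod (fun i w => f i (X i w))) _.
  apply: etrans _ (esym (split_prod (fun i => l i (f i)))).
  apply: (mean_operator_ext (mX i0) (bl i0)) => //.
  - apply: bounded_measurableM => //; apply: bounded_measurable_prod => i.
    exact: bounded_measurable_comp.
  - apply: bounded_measurableM => //; apply: bounded_measurable_prod => i.
    exact: operator_bounded_measurable.
  (* With the other factors frozen in the two weights, only indicators at [i0] remain to be checked,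
     and these fall under the induction hypothesis. *)
  move=> B mB; pose f' i := if i == i0 then \1_B else f i.
  have eqp (G : 'I_N -> (E -> R) -> T -> R) :
      \int[P]_w (G i0 \1_B w * (\1_A w * \prod_(i | i != i0) G i (f i) w)) =
      \int[P]_w (\1_A w * \prod_i G i (f' i) w).
    rewrite split_prod /f' eqxx; apply: eq_Rintegral => w _; congr (_ * (_ * _)).
    by apply: eq_bigr => i /negbTE ->.
  apply: etrans (eqp (fun i h w => h (X i w))) _.
  apply: etrans _ (esym (eqp l)); apply: IH => i; rewrite /f'.
    by case: ifP => _ //; exact: bounded_measurable_indic.
  move=> mi; case: eqP => [_|/eqP ni]; first by exists B.
  apply: fB; rewrite ltn_neqAle mi andbT; apply: contra ni => /eqP mi'.
  by apply/eqP/val_inj.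
by move=> f bf; apply: (H N) => // i; rewrite leqNgt ltn_ord.
Qed.

End operator_extension.

(** Measurability for the generated sigma-algebra is carried by the type of [Z]. The identity map
    into that coarser space is measurable, so [mean_operator_ext] applies with the identity as
    operator. *)
Lemma sub_sigma_algebra_mean_ext {R : realType} {d} {T : measurableType d}
    (P : probability T R) (G : set (set T)) (V W : T -> R) :
  G `<=` measurable -> bounded_measurable V -> bounded_measurable W ->
  (forall A, <<s G >> A ->
    \int[P]_w (\1_A w * V w) = \int[P]_w (\1_A w * W w)) ->
  forall Z : g_sigma_algebraType G -> R, bounded_measurable Z ->
    \int[P]_w (Z w * V w) = \int[P]_w (Z w * W w).
Proof.
move=> GT bV bW VW.
have mid : measurable_fun [set: T] (id : T -> g_sigma_algebraType G).
  move=> _ B mB; rewrite setTI preimage_id; move: B mB.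
  apply: smallest_sub => //; exact: sigma_algebra_measurable.
apply: (mean_operator_ext mid) => //.
split=> // f bf; exact: (bounded_measurable_comp mid bf).
Qed.

(** * Markov kernels as operators on bounded measurable functions *)

Section kernel_operator.
Context {R : realType} {d} {E : measurableType d} (K : R.-pker E ~> E).

(** A name for the measure [K x], to which a probability structure is attached so that the lemmas on
    means apply to [kernel_apply]. *)
Definition kernel_law (x : E) : set E -> \bar R := K x.

HB.instance Definition _ x := Measure.copy (kernel_law x) (K x).

Let kernel_law_setT x : kernel_law x [set: E] = 1%E.
Proof. exact: prob_kernel. Qed.

HB.instance Definition _ x :=
  Measure_isProbability.Build d E R (kernel_law x) (kernel_law_setT x).

Lemma kernel_applyE f x : kernel_apply K f x = \int[kernel_law x]_y f y.
Proof. by []. Qed.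

Lemma kernel_apply_bounded_operator : bounded_operator (kernel_apply K).
Proof.
split=> [f bf|f g bf bg|c f bf|f M bf fM w].
- have [mf [M fM]] := bf; split; last first.
    by exists M => x; rewrite kernel_applyE; exact: norm_mean_le.
  (* The shift by [M] makes the integrand nonnegative, as the measurability result for kernel
     integrals requires; it is subtracted again below. *)
  have bfM := bounded_measurableD bf (bounded_measurable_cst M).
  have fM0 x : (0 <= (f x + M)%:E)%E.
    by have := fM x; rewrite lee_fin ler_norml => /andP[]; lra.
  have mK U : measurable U -> measurable_fun [set: E] (K ^~ U).
    exact: measurable_kernel.
  have := measurable_fun_integral_kernel mK fM0.
  have /measurable_EFinP mfM : measurable_fun [set: E] (fun x => f x + M).
    exact: bfM.1.
  move=> /(_ mfM) mKfM.
  have -> : kernel_apply K f = fun x => fine (\int[K x]_y (f y + M)%:E)%E - M.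
    apply/funext => x; rewrite kernel_applyE.
    rewrite -[X in X - M]/(\int[kernel_law x]_y (f y + M)).
    rewrite meanD ?mean_cst ?addrK//; exact: bounded_measurable_cst.
  by apply: measurable_funB => //; exact: measurableT_comp.
- by apply/funext => w; rewrite !kernel_applyE meanD.
- by apply/funext => w; rewrite !kernel_applyE meanZ.
- by rewrite kernel_applyE; exact: norm_mean_le.
Qed.

Lemma bounded_measurable_kernel f : bounded_measurable f ->
  bounded_measurable (kernel_apply K f).
Proof. by case: kernel_apply_bounded_operator => bK _ _ _; exact: bK. Qed.

Lemma kernel_apply_indic x B : measurable B ->
  K x B = (kernel_apply K \1_B x)%:E.
Proof.
move=> mB; rewrite kernel_applyE mean_indic// fineK//.
exact: fin_num_measure.
Qed.

Lemma kernel_apply_cst (c : R) x : kernel_apply K (fun=> c) x = c.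
Proof. by rewrite kernel_applyE mean_cst. Qed.

Lemma sqr_kernel_apply_le f x : bounded_measurable f ->
  kernel_apply K f x ^+ 2 <= kernel_apply K (fun y => f y ^+ 2) x.
Proof. by move=> bf; rewrite !kernel_applyE sqr_mean_le. Qed.

Lemma kernel_apply_ge0 f x : (forall y, 0 <= f y) -> 0 <= kernel_apply K f x.
Proof. by move=> f0; rewrite kernel_applyE mean_ge0. Qed.

(** Stationarity speaks of events; [mean_operator_ext], with the identity for [X] and both weights
    [1], extends it to functions. *)
Lemma mean_stationary (mu : probability E R) f :
  stationary mu K -> bounded_measurable f ->
  \int[mu]_x kernel_apply K f x = \int[mu]_x f x.
Proof.
move=> muK bf.
have := @mean_operator_ext R _ _ E E mu id (kernel_apply K) (cst 1) (cst 1).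
move=> /(_ (@measurable_id _ _ _) kernel_apply_bounded_operator).
move=> /(_ (bounded_measurable_cst 1) (bounded_measurable_cst 1)).
have mulr_cst (h : E -> R) : \int[mu]_x (h x * cst 1 x) = \int[mu]_x h x.
  by apply: eq_Rintegral => x _; rewrite mulr1.
move=> /(_ _ f bf); rewrite !mulr_cst => -> // B mB; rewrite !mulr_cst.
rewrite mean_indic// -muK// /Rintegral; congr fine.
by apply: eq_integral => x _; rewrite kernel_apply_indic.
Qed.

End kernel_operator.

(** * Lebesgue norms and moments *)

Section lebesgue_norms.
Context {R : realType} {d} {T : measurableType d} (mu : probability T R).
Implicit Types f : T -> R.

Lemma bounded_measurable_powR p f : 0 <= p -> bounded_measurable f ->
  bounded_measurable (fun x => `|f x| `^ p).
Proof.
move=> p0 [mf [M fM]]; split.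
  apply: (@measurableT_comp _ _ _ _ _ _ (@powR R ^~ p)) => //.
  exact: measurableT_comp.
exists (M `^ p) => x; rewrite ger0_norm ?powR_ge0//.
by rewrite ge0_ler_powR// nnegrE ?(le_trans _ (fM x)).
Qed.

Lemma Lnorm_mean p f : 0 < p -> bounded_measurable f ->
  'N[mu]_p%:E[EFin \o f]%E = ((\int[mu]_x (`|f x| `^ p)) `^ p^-1)%:E.
Proof.
move=> p0 bf; rewrite unlock /Lnorm -poweR_EFin -EFin_mean//.
exact: bounded_measurable_powR (ltW p0) bf.
Qed.

(** Hölder's inequality for [|f|^p] and the constant [1], with exponent [q / p]; [mu] has total mass
    [1]. The case [p = q] is split off because the conjugate exponent is then infinite. *)
Lemma le_Lnorm p q f : 0 < p -> p <= q -> bounded_measurable f ->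
  ('N[mu]_p%:E[EFin \o f] <= 'N[mu]_q%:E[EFin \o f])%E.
Proof.
move=> p0; rewrite le_eqVlt => /predU1P[->//|pq] bf.
have q0 : 0 < q := lt_trans p0 pq.
pose r := q / p; pose r' := (1 - r^-1)^-1.
have r0 : 0 < r by rewrite divr_gt0.
have r'0 : 0 < r'.
  by rewrite invr_gt0 subr_gt0 invf_lt1// /r ltr_pdivlMr// mul1r.
have rr' : r^-1 + r'^-1 = 1 by rewrite /r' invrK; ring.
pose h x := `|f x| `^ p.
have bh : bounded_measurable h by exact: bounded_measurable_powR (ltW p0) bf.
have h0 x : 0 <= h x by exact: powR_ge0.
have b1 : bounded_measurable (cst 1 : T -> R) := bounded_measurable_cst 1.
have bh1 : bounded_measurable (h \* cst 1) by exact: bounded_measurableM.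
have hoelder_h : (\int[mu]_x (`|(h \* cst 1) x| `^ 1)) `^ 1^-1 <=
    (\int[mu]_x (`|h x| `^ r)) `^ r^-1 *
    (\int[mu]_x (`|cst 1 x| `^ r')) `^ r'^-1.
  have := hoelder mu bh.1 b1.1 r0 r'0 rr'.
  by rewrite (Lnorm_mean ltr01 bh1) (Lnorm_mean r0 bh) (Lnorm_mean r'0 b1).
rewrite (Lnorm_mean p0 bf) (Lnorm_mean q0 bf) lee_fin.
move: hoelder_h; rewrite invr1.
have -> : \int[mu]_x `|(h \* cst 1) x| `^ 1 = \int[mu]_x h x.
  by apply: eq_Rintegral => x _ /=; rewrite powRr1// mulr1 ger0_norm.
have -> : \int[mu]_x `|cst 1 x| `^ r' = 1 :> R.
  rewrite -[RHS](mean_cst mu 1); apply: eq_Rintegral => x _ /=.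
  by rewrite normr1 powR1.
have -> : \int[mu]_x `|h x| `^ r = \int[mu]_x (`|f x| `^ q).
  apply: eq_Rintegral => x _; rewrite ger0_norm// /h -powRrM.
  by rewrite /r mulrCA divff ?gt_eqF// mulr1.
have Ih0 : 0 <= \int[mu]_x h x by exact: mean_ge0.
rewrite powR1 mulr1 (powRr1 Ih0) => H.
have p'0 : 0 <= p^-1 by rewrite invr_ge0 ltW.
apply: le_trans (ge0_ler_powR p'0 _ _ H) _; rewrite ?nnegrE ?powR_ge0//.
rewrite -powRrM (_ : r^-1 * p^-1 = q^-1)//.
by rewrite /r invf_div mulrAC divff ?mul1r// gt_eqF.
Qed.

Lemma Lnorm_even m f : (0 < m)%N -> ~~ odd m -> bounded_measurable f ->
  'N[mu]_(m%:R)%:E[EFin \o f]%E = ((\int[mu]_x (f x ^+ m)) `^ (m%:R)^-1)%:E.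
Proof.
move=> m0 m2 bf; rewrite Lnorm_mean ?ltr0n//; congr (_ `^ _)%:E.
apply: eq_Rintegral => x _; rewrite powR_mulrn//.
by rewrite -normrX ger0_norm// exprn_even_ge0.
Qed.

(** For even [m] both the root and the absolute value disappear. An equality of propositions can be
    rewritten in either direction. *)
Lemma Lnorm_even_le m f (F : R) : (0 < m)%N -> ~~ odd m -> 0 <= F ->
  bounded_measurable f ->
  ('N[mu]_(m%:R)%:E[EFin \o f] <= F%:E)%E = (\int[mu]_x (f x ^+ m) <= F ^+ m).
Proof.
move=> m0 m2 F0 bf; rewrite Lnorm_even// lee_fin.
set I := \int[mu]_x _; have I0 : 0 <= I.
  by apply: mean_ge0 => x; exact: exprn_even_ge0.
have IE : I = (I `^ (m%:R)^-1) ^+ m.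
  by rewrite -powR_mulrn ?powR_ge0// -powRrM mulVf ?powRr1// pnatr_eq0 -lt0n.
by rewrite [in RHS]IE ler_pXn2r// nnegrE powR_ge0.
Qed.

End lebesgue_norms.

Lemma odd_2X (m : nat) : odd (2 ^ m.+1) = false.
Proof. by rewrite oddX. Qed.

(** * Moments after one step of weighting and applying a kernel *)

Section pushed_weight.
Context {R : realType} {d} {E : measurableType d}.
Context (mu mu' : probability E R) (G : E -> R) (K : R.-pker E ~> E).
Context (gamma : R).
Hypothesis G_bounded : bounded_measurable G.
Hypothesis G_ge0 : forall x, 0 <= G x.
Hypothesis G_le : forall x, G x <= gamma.
Hypothesis G_density : forall f, bounded_measurable f ->
  \int[mu]_x (G x * f x) = \int[mu']_x f x.
Hypothesis K_stationary : stationary mu' K.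

Let bK f : bounded_measurable f -> bounded_measurable (kernel_apply K f).
Proof. exact: bounded_measurable_kernel. Qed.

(** Of the [m.+1] factors [G], [m] are bounded by [gamma] and the last one changes [mu] into
    [mu']. *)
Lemma mean_weight_exp_le f m : bounded_measurable f ->
  (forall x, 0 <= f x ^+ m.+1) ->
  \int[mu]_x ((G x * f x) ^+ m.+1) <= gamma ^+ m * \int[mu']_x (f x ^+ m.+1).
Proof.
move=> bf f0; have bfm := bounded_measurableX m.+1 bf.
rewrite -G_density// -meanZ; last exact: bounded_measurableM.
apply: le_mean; [bounded_measurability..|move=> x].
rewrite exprMn exprSr -!mulrA ler_wpM2r ?mulr_ge0// lerXn2r// ?nnegrE//.
exact: le_trans (G_le x).
Qed.

(** Jensen's inequality for the square, applied [r] times. One square stays outside the kernel,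
    since the spectral gap is an L_2 statement. *)
Lemma kernel_apply_exp2_le f r x : bounded_measurable f ->
  kernel_apply K f x ^+ (2 ^ r.+1) <=
  kernel_apply K (fun y => f y ^+ (2 ^ r)) x ^+ 2.
Proof.
move=> bf; elim: r => [|r IH]; first by rewrite expn1.
rewrite [in leLHS]expnSr exprM lerXn2r// ?nnegrE ?exprn_even_ge0 ?odd_2X//.
  by apply: kernel_apply_ge0 => y; rewrite exprn_even_ge0// odd_2X.
apply: le_trans IH _; rewrite (le_trans (sqr_kernel_apply_le _ _ _))//.
  exact: bounded_measurableX.
by under [in leRHS]eq_fun do rewrite expnSr exprM.
Qed.

Context (delta : R).
Hypothesis delta_ge0 : 0 <= delta.
Hypothesis K_gap : forall f, bounded_measurable f ->
  \int[mu']_x ((kernel_apply K f x - \int[mu']_y f y) ^+ 2) <=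
  delta * \int[mu']_x ((f x - \int[mu']_y f y) ^+ 2).

(** By stationarity [f] and its image under the kernel have the same mean, so the gap compares their
    variances; the term with [- delta] times the squared mean is dropped. *)
Lemma mean_sqr_kernel_le f : bounded_measurable f ->
  \int[mu']_x (kernel_apply K f x ^+ 2) <=
  delta * \int[mu']_x (f x ^+ 2) + (\int[mu']_x f x) ^+ 2.
Proof.
move=> bf; have := variance_mean mu' (bK bf).
rewrite mean_stationary// => vK; have := K_gap bf.
rewrite vK variance_mean//; have := mulr_ge0 delta_ge0 (sqr_ge0 (\int[mu']_x f x)).
by lra.
Qed.

Lemma mean_moment_le f r : bounded_measurable f ->
  \int[mu]_x ((G x * kernel_apply K f x) ^+ (2 ^ r.+1)) <=
  gamma ^+ (2 ^ r.+1).-1 * (delta * \int[mu']_x (f x ^+ (2 ^ r.+1))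
    + (\int[mu']_x (f x ^+ (2 ^ r))) ^+ 2).
Proof.
move=> bf; have m0 : (0 < 2 ^ r.+1)%N by rewrite expn_gt0.
have := @mean_weight_exp_le (kernel_apply K f) (2 ^ r.+1).-1 (bK bf).
rewrite prednK// => /(_ _) H; apply: le_trans (H _) _ => [x|].
  by rewrite exprn_even_ge0// odd_2X.
(* The sign of [gamma] is read off at the default point of [E]. *)
have gamma_ge0 : 0 <= gamma := le_trans (G_ge0 point) (G_le point).
rewrite ler_wpM2l ?exprn_ge0//.
have bfr := bounded_measurableX (2 ^ r) bf.
apply: (@le_trans _ _
    (\int[mu']_x (kernel_apply K (fun y => f y ^+ (2 ^ r)) x ^+ 2))).
  apply: le_mean => [||x]; last exact: kernel_apply_exp2_le.
    exact/bounded_measurableX/bK.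
  exact/bounded_measurableX/bK.
apply: le_trans (mean_sqr_kernel_le bfr) _.
by under eq_Rintegral do rewrite -exprM -expnSr.
Qed.

End pushed_weight.

(** * The particle system *)

Section conditionally_iid.
Context {R : realType} {dT dE} {T : measurableType dT} {E : measurableType dE}.
Context (P : probability T R) (N : nat) (X : 'I_N -> T -> E) (Z : T -> R).
Context (m : (E -> R) -> T -> R).
Hypothesis X_measurable : forall i, measurable_fun [set: T] (X i).
Hypothesis Z_bounded : bounded_measurable Z.
Hypothesis m_cst1 : forall w, m (fun=> 1) w = 1.
Hypothesis X_law : forall f : 'I_N -> E -> R,
  (forall i, bounded_measurable (f i)) ->
  \int[P]_w (Z w * \prod_i f i (X i w)) = \int[P]_w (Z w * \prod_i m (f i) w).

Let mean1 h i : bounded_measurable h ->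
  \int[P]_w (Z w * h (X i w)) = \int[P]_w (Z w * m h w).
Proof.
move=> bh; pose f j : E -> R := if j == i then h else fun=> 1.
(* Abstracting over [F] lets one computation collapse both the product over the variables and the
   product of their conditional means. *)
have prodE (F : (E -> R) -> 'I_N -> R) : (forall j, F (fun=> 1) j = 1) ->
    \prod_j F (f j) j = F h i.
  move=> F1; rewrite (bigD1 i)//= {1}/f eqxx big1 ?mulr1// => j /negbTE ji.
  by rewrite /f ji.
have -> : \int[P]_w (Z w * h (X i w)) = \int[P]_w (Z w * \prod_j f j (X j w)).
  apply: eq_Rintegral => w _; congr (_ * _).
  exact/esym/(prodE (fun u j => u (X j w))).
rewrite X_law; last first.
  by move=> j; rewrite /f; case: ifP => _ //; exact: bounded_measurable_cst.
apply: eq_Rintegral => w _; congr (_ * _).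
by apply: (prodE (fun u _ => m u w)).
Qed.

Let mean2 h i j : bounded_measurable h -> j != i ->
  \int[P]_w (Z w * (h (X i w) * h (X j w))) = \int[P]_w (Z w * (m h w ^+ 2)).
Proof.
move=> bh ji; pose f l : E -> R := if (l == i) || (l == j) then h else fun=> 1.
have prodE (F : (E -> R) -> 'I_N -> R) : (forall l, F (fun=> 1) l = 1) ->
    \prod_l F (f l) l = F h i * F h j.
  move=> F1; rewrite (bigD1 i)//= (bigD1 j)//= {1 2}/f !eqxx orbT.
  rewrite big1 ?mulr1// => l /andP[/negbTE li /negbTE lj].
  by rewrite /f li lj.
have -> : \int[P]_w (Z w * (h (X i w) * h (X j w))) =
    \int[P]_w (Z w * \prod_l f l (X l w)).
  apply: eq_Rintegral => w _; congr (_ * _).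
  exact/esym/(prodE (fun u l => u (X l w))).
rewrite X_law; last first.
  by move=> l; rewrite /f; case: ifP => _ //; exact: bounded_measurable_cst.
apply: eq_Rintegral => w _; congr (_ * _); rewrite expr2.
by apply: (prodE (fun u _ => m u w)).
Qed.

Lemma mean_empirical h : (0 < N)%N -> bounded_measurable h ->
  \int[P]_w (Z w * (N%:R^-1 * \sum_i h (X i w))) = \int[P]_w (Z w * m h w).
Proof.
move=> N0 bh.
have bZh i : bounded_measurable (fun w => Z w * h (X i w)).
  exact/bounded_measurableM/(bounded_measurable_comp (X_measurable i)).
have -> : \int[P]_w (Z w * (N%:R^-1 * \sum_i h (X i w))) =
    \int[P]_w (N%:R^-1 * \sum_i Z w * h (X i w)).
  by apply: eq_Rintegral => w _; rewrite -mulr_sumr; ring.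
rewrite meanZ; last exact: bounded_measurable_sum.
rewrite mean_sum//; under eq_bigr do rewrite mean1//.
rewrite sumr_const card_ord -[X in _ * X]mulr_natl mulrA mulVf ?mul1r//.
by rewrite pnatr_eq0 -lt0n.
Qed.

(** In the double sum, [N] diagonal terms give [m (h^2)] and [N (N - 1)] off-diagonal terms give
    [(m h)^2]. *)
Lemma mean_sqr_empirical h : (0 < N)%N -> bounded_measurable h ->
  N%:R * \int[P]_w (Z w * (N%:R^-1 * \sum_i h (X i w)) ^+ 2) =
  \int[P]_w (Z w * m (fun x => h x ^+ 2) w) +
  (N%:R - 1) * \int[P]_w (Z w * m h w ^+ 2).
Proof.
move=> N0 bh; have bX i := bounded_measurable_comp (X_measurable i) bh.
have N_neq0 : N%:R != 0 :> R by rewrite pnatr_eq0 -lt0n.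
have bZh i j : bounded_measurable (fun w => Z w * (h (X i w) * h (X j w))).
  by apply: bounded_measurableM => //; exact: bounded_measurableM.
have -> : \int[P]_w (Z w * (N%:R^-1 * \sum_i h (X i w)) ^+ 2) =
    \int[P]_w (N%:R^-1 ^+ 2 * \sum_i \sum_j (Z w * (h (X i w) * h (X j w)))).
  apply: eq_Rintegral => w _.
  rewrite exprMn [X in _ * (_ * X)]expr2 mulr_suml mulrCA; congr (_ * _).
  rewrite mulr_sumr; apply: eq_bigr => i _.
  by rewrite mulr_sumr mulr_sumr.
rewrite meanZ; last by do 2 apply: bounded_measurable_sum => ?.
rewrite mean_sum; last by move=> i; exact: bounded_measurable_sum.
have -> : \sum_i \int[P]_w (\sum_j (Z w * (h (X i w) * h (X j w)))) =
    \sum_(i < N) (\int[P]_w (Z w * m (fun x => h x ^+ 2) w) +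
      (N%:R - 1) * \int[P]_w (Z w * m h w ^+ 2)).
  apply: eq_bigr => i _; rewrite mean_sum// (bigD1 i)//=; congr (_ + _).
    rewrite -(mean1 i (bounded_measurableX 2 bh)).
    by apply: eq_Rintegral => w _; rewrite expr2.
  under eq_bigr => j ji do rewrite (mean2 bh ji).
  by rewrite sumr_const cardC1 card_ord -[LHS]mulr_natl -subn1 natrB.
rewrite sumr_const card_ord; set S := _ + _; rewrite -(mulr_natl S); field.
exact: N_neq0.
Qed.

End conditionally_iid.

(** * Normalised weights and the operators [q] *)

Section particle_moments.
Context {R : realType} {d} {E : measurableType d}.
Context (mu : nat -> probability E R) (g : nat -> E -> R).
Context (K : nat -> R -> R.-pker E ~> E) (t : nat -> R) (n : nat).
Hypothesis g_bounded : forall k, (1 <= k <= n)%N -> bounded_measurable (g k).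
Hypothesis g_gt0 : forall k, (1 <= k <= n)%N -> forall x, 0 < g k x.
Hypothesis g_density : forall k, (1 <= k <= n)%N ->
  forall f, bounded_measurable f -> \int[mu k]_x f x =
    (\int[mu k.-1]_x (g k x * f x)) / (\int[mu k.-1]_x g k x).
Hypothesis K_stationary : forall k, (1 <= k <= n)%N ->
  stationary (mu k) (K k (t k)).

Implicit Types f h : E -> R.
Local Notation gbar := (gbar mu g).
Local Notation q := (q mu g K t).

(* If the normalising constant were [0], then [g_density] at [f = 1] would read
   [1 = 0], because Rocq's division by [0] gives [0]. *)
Lemma mean_weight_gt0 k : (1 <= k <= n)%N -> 0 < \int[mu k.-1]_x g k x.
Proof.
move=> kn; rewrite lt0r mean_ge0; last by move=> x; exact/ltW/g_gt0.
rewrite andbT; apply/eqP => g0; have := g_density kn (bounded_measurable_cst 1).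
by rewrite mean_cst g0 invr0 mulr0 => /eqP; rewrite oner_eq0.
Qed.

Lemma bounded_measurable_gbar k : (1 <= k <= n)%N -> bounded_measurable (gbar k).
Proof.
move=> kn; apply: bounded_measurableM; first exact: g_bounded.
exact: bounded_measurable_cst.
Qed.

Lemma gbar_gt0 k x : (1 <= k <= n)%N -> 0 < gbar k x.
Proof. by move=> kn; rewrite divr_gt0 ?g_gt0 ?mean_weight_gt0. Qed.

Lemma mean_gbar k f : (1 <= k <= n)%N -> bounded_measurable f ->
  \int[mu k.-1]_x (gbar k x * f x) = \int[mu k]_x f x.
Proof.
move=> kn bf; rewrite (g_density kn bf) [RHS]mulrC -meanZ; last first.
  by apply: bounded_measurableM => //; exact: g_bounded.
by apply: eq_Rintegral => x _; rewrite /Defs.gbar; ring.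
Qed.

Lemma bounded_measurable_q k f : (1 <= k <= n)%N -> bounded_measurable f ->
  bounded_measurable (q k f).
Proof.
move=> kn bf; apply: bounded_measurableM; first exact: bounded_measurable_gbar.
exact: bounded_measurable_kernel.
Qed.

Lemma q_cst1 k : q k (cst 1) = gbar k.
Proof. by apply/funext => x; rewrite /Defs.q kernel_apply_cst mulr1. Qed.

Lemma mean_q k f : (1 <= k <= n)%N -> bounded_measurable f ->
  \int[mu k.-1]_x q k f x = \int[mu k]_x f x.
Proof.
move=> kn bf; rewrite mean_gbar//; last exact: bounded_measurable_kernel.
by apply: mean_stationary => //; exact: K_stationary.
Qed.

(** * The past, resampling and the conditional law of a generation *)

Context {N : nat} {dO} {Omega : measurableType dO} (P : probability Omega R).
Context (xi xihat : nat -> 'I_N -> Omega -> E).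
Hypothesis N_gt0 : (0 < N)%N.
Hypothesis xi_system : is_particle_system mu g K t P xi xihat n.

(** The family generating [past], named so that measurability with respect to the past can be
    expressed through [g_sigma_algebraType]. *)
Definition past_generator k l : set (set Omega) :=
  [set A | exists j i B, measurable B /\
    ((j < k)%N /\ A = xi j i @^-1` B \/
     (0 < j < l)%N /\ A = xihat j i @^-1` B)].

Lemma past_generator_measurable k l : (k <= n.+1)%N -> (l <= n.+1)%N ->
  past_generator k l `<=` measurable.
Proof.
move=> kn ln A [j [i [B [mB [[jk ->]|[jl ->]]]]]]; rewrite -[_ @^-1` _]setTI.
  by apply: (xi_measurable xi_system) => //; rewrite -ltnS (leq_trans jk).
apply: (xihat_measurable xi_system) => //.
by case/andP: jl => -> jl; rewrite -ltnS (leq_trans jl).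
Qed.

(** The sigma-algebra on the source is left open: the result serves on [Omega] and, through [phi],
    on the coarser space of the past. *)
Lemma bounded_measurable_eta d' (T : measurableType d')
    (X : nat -> 'I_N -> T -> E) k (f : E -> R) :
  (forall i, measurable_fun [set: T] (X k i)) -> bounded_measurable f ->
  bounded_measurable (Defs.eta X k f).
Proof.
move=> mX bf; apply: bounded_measurableZ; apply: bounded_measurable_sum => i.
exact: bounded_measurable_comp.
Qed.

Lemma bounded_measurable_phi d' (T : measurableType d')
    (X : nat -> 'I_N -> T -> E) k : (k <= n)%N ->
  (forall j i, (j < k)%N -> measurable_fun [set: T] (X j i)) ->
  bounded_measurable (Defs.phi mu g K t X k).
Proof.
move=> kn mX; rewrite /Defs.phi.
apply: bounded_measurable_prod => j; apply: bounded_measurable_eta => [i|].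
  exact: mX.
rewrite q_cst1; apply: bounded_measurable_gbar.
by rewrite /= (leq_trans (ltn_ord j)).
Qed.

Let eta_bounded k f : (k <= n)%N -> bounded_measurable f ->
  bounded_measurable (Defs.eta xi k f).
Proof.
move=> kn; apply: bounded_measurable_eta => i.
exact: (xi_measurable xi_system).
Qed.

Let phi_bounded k : (k <= n)%N -> bounded_measurable (Defs.phi mu g K t xi k).
Proof.
move=> kn; apply: bounded_measurable_phi => // j i jk.
by apply: (xi_measurable xi_system); rewrite (leq_trans (ltnW jk)).
Qed.

Local Notation nu := (Defs.nu mu g K t xi).
Local Notation phi := (Defs.phi mu g K t xi).

Lemma bounded_measurable_nu k f : (k <= n)%N -> bounded_measurable f ->
  bounded_measurable (nu k f).
Proof.
move=> kn bf; apply: bounded_measurableM; first exact: phi_bounded.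
exact: eta_bounded.
Qed.

(** Turns the normalising product into a value of [nu k], which is how the covariance enters the
    recursion. *)
Lemma phiS k : phi k.+1 = nu k (gbar k.+1).
Proof. by apply/funext => w; rewrite /Defs.phi big_ord_recr /= q_cst1. Qed.

Lemma phi0 w : phi 0 w = 1.
Proof. by rewrite /Defs.phi big_ord0. Qed.

(** The mean of [f] under [resampling_law], as a single quotient whose denominator will cancel
    against a factor of [phi]. *)
Definition resampled k (f : E -> R) (w : Omega) : R :=
  (\sum_(i < N) g k (xi k.-1 i w) * f (xi k.-1 i w)) /
  \sum_(i < N) g k (xi k.-1 i w).

Lemma total_weight_gt0 k w : (1 <= k <= n)%N ->
  0 < \sum_(i < N) g k (xi k.-1 i w).
Proof.
move=> kn; rewrite (bigD1 (Ordinal N_gt0))//= ltr_pwDl ?g_gt0//.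
by apply: sumr_ge0 => i _; exact/ltW/g_gt0.
Qed.

Lemma resampledE k f w : resampled k f w =
  \sum_(i < N) (g k (xi k.-1 i w) / \sum_(l < N) g k (xi k.-1 l w)) *
    f (xi k.-1 i w).
Proof.
by rewrite /resampled mulr_suml; apply: eq_bigr => i _; ring.
Qed.

Lemma resampled_norm_le k f M w : (1 <= k <= n)%N ->
  (forall x, `|f x| <= M) -> `|resampled k f w| <= M.
Proof.
move=> kn fM; have W0 := total_weight_gt0 w kn.
rewrite /resampled normrM normfV (gtr0_norm W0) ler_pdivrMr//.
rewrite (le_trans (ler_norm_sum _ _ _))// mulr_sumr ler_sum// => i _.
by rewrite normrM (gtr0_norm (g_gt0 kn _)) mulrC ler_wpM2r// ltW// g_gt0.
Qed.

Lemma bounded_operator_resampled k : (1 <= k <= n)%N ->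
  bounded_operator (resampled k).
Proof.
move=> kn; have mX i : measurable_fun [set: Omega] (xi k.-1 i).
  apply: (xi_measurable xi_system).
  by case/andP: kn => _; exact: leq_trans (leq_pred _).
split=> [f bf|f h bf bh|c f bf|f M bf fM w]; last exact: resampled_norm_le.
- have [_ [M fM]] := bf; split; last first.
    by exists M => w; exact: resampled_norm_le.
  have bsum h : bounded_measurable h ->
      bounded_measurable (fun w => \sum_(i < N) h (xi k.-1 i w)).
    move=> bh; apply: bounded_measurable_sum => i.
    exact: bounded_measurable_comp.
  have bgf : bounded_measurable (fun x => g k x * f x).
    by apply: bounded_measurableM => //; exact: g_bounded.
  apply: measurable_funM; first exact: (bsum _ bgf).1.
  have W w : 0 <= \sum_(i < N) g k (xi k.-1 i w).
    exact/ltW/total_weight_gt0.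
  (* The reciprocal of the total weight is a power with exponent [-1], hence measurable. *)
  under eq_fun do rewrite -(powR_inv1 (W _)).
  have := measurableT_comp (measurable_powR (-1)) (bsum _ (g_bounded kn)).1.
  exact.
- apply/funext => w; rewrite /resampled -mulrDl -big_split/=; congr (_ / _).
  by apply: eq_bigr => i _; ring.
- apply/funext => w; rewrite /resampled mulrA mulr_sumr; congr (_ / _).
  by apply: eq_bigr => i _; ring.
Qed.

(** The tower property: mutation is integrated out given the selected particles, then selection
    given the past. It suffices to treat indicators in place of [Z]. *)
Lemma particle_law k (Z : g_sigma_algebraType (past_generator k.+1 k.+1) -> R)
    (f : 'I_N -> E -> R) :
  (k < n)%N -> bounded_measurable Z -> (forall i, bounded_measurable (f i)) ->
  \int[P]_w (Z w * \prod_i f i (xi k.+1 i w)) =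
  \int[P]_w (Z w * \prod_(i < N)
    resampled k.+1 (kernel_apply (K k.+1 (t k.+1)) (f i)) w).
Proof.
move=> kn bZ bf; have k1n : (1 <= k.+1 <= n)%N by [].
have mxi i : measurable_fun [set: Omega] (xi k.+1 i).
  exact: (xi_measurable xi_system).
have mxihat i : measurable_fun [set: Omega] (xihat k.+1 i).
  exact: (xihat_measurable xi_system).
have bop := bounded_operator_resampled k1n.
set Kk := K k.+1 (t k.+1).
have bKf i : bounded_measurable (kernel_apply Kk (f i)).
  exact: bounded_measurable_kernel.
(* The mutation law also conditions on [xihat k.+1], so an event of the past has to be viewed in
   this larger sigma-algebra. *)
have past_le A : past xi xihat k.+1 k.+1 A -> past xi xihat k.+1 k.+2 A.
  apply: sub_sigma_algebra2 => {}A.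
  move=> [j [i [B [mB jA]]]]; exists j, i, B; split => //.
  case: jA => [|[/andP[j0 jk] ->]]; [by left|right].
  by rewrite j0 (ltn_trans jk).
have generator_sub : past_generator k.+1 k.+1 `<=` measurable.
  by apply: past_generator_measurable; rewrite ltnS ltnW.
have past_measurable A : past xi xihat k.+1 k.+1 A -> measurable A.
  by apply: smallest_sub => //; exact: sigma_algebra_measurable.
apply: (sub_sigma_algebra_mean_ext (G := past_generator k.+1 k.+1)) => //.
- apply: bounded_measurable_prod => i; exact: bounded_measurable_comp.
- apply: bounded_measurable_prod => i.
  by case: bop => bR _ _ _; exact: bR.
move=> A pA; have mA := past_measurable _ pA.
transitivity (\int[P]_w (\1_A w *
    \prod_(i < N) kernel_apply Kk (f i) (xihat k.+1 i w))).
  apply: (mean_prod_operator_ext mxi (L := fun i w => Kk (xihat k.+1 i w))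
    (l := fun i h w => kernel_apply Kk h (xihat k.+1 i w))) => //.
  - move=> i; have [bK KD KZ KN] := kernel_apply_bounded_operator Kk.
    split=> [h bh|h h' bh bh'|c h bh|h M bh hM w].
    + by apply: bounded_measurable_comp => //; exact: bK.
    + by rewrite KD.
    + by rewrite KZ.
    + exact: KN.
  - by move=> i w B mB; rewrite kernel_apply_indic.
  - move=> B mB; apply: (xi_mutation xi_system) => //; exact: past_le.
apply: (mean_prod_operator_ext mxihat
  (L := fun _ w => resampling_law (g k.+1) (fun i => xi k i w))
  (l := fun _ => resampled k.+1)) => //.
- move=> i w B mB; rewrite resampledE /resampling_law -sumEFin.
  by apply: eq_bigr => l _; rewrite diracE EFinM indicE.
- by move=> B mB; apply: (xihat_selection xi_system).
Qed.

(** Only generations up to [k] enter [phi k.+1], so it may serve as the weight [Z] in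
    [particle_law]. *)
Lemma past_bounded_phi k : (k < n)%N ->
  @bounded_measurable R _ (g_sigma_algebraType (past_generator k.+1 k.+1))
    (phi k.+1).
Proof.
move=> kn; apply: (@bounded_measurable_phi _
  (g_sigma_algebraType (past_generator k.+1 k.+1)) xi) => // j i jk.
move=> _ B mB; rewrite setTI; apply: sub_sigma_algebra.
by exists j, i, B; split => //; left.
Qed.

(** The last factor of [phi k.+1] is the total weight divided by [N] and by the normalising
    constant; it cancels the denominator of [resampled]. *)
Lemma phi_resampled k f w : (k < n)%N ->
  phi k.+1 w * resampled k.+1 (kernel_apply (K k.+1 (t k.+1)) f) w =
  nu k (q k.+1 f) w.
Proof.
move=> kn; rewrite phiS /Defs.nu -mulrA; congr (_ * _).
rewrite /Defs.eta /resampled /Defs.q /Defs.gbar.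
under eq_bigr do rewrite mulrC.
under [in RHS]eq_bigr do rewrite mulrAC mulrC.
rewrite -!mulr_sumr /=; have := @total_weight_gt0 k.+1 w kn; rewrite /=.
have := @mean_weight_gt0 k.+1 kn; rewrite /=.
set W := \sum_(i < N) g _ _ => Z0 W0; field.
rewrite (gt_eqF W0) (gt_eqF Z0)/=.
by rewrite pnatr_eq0 -lt0n N_gt0.
Qed.

(** * Recursions for the first two moments of [nu] *)

Let resampled_kernel1 k w : (k < n)%N ->
  resampled k.+1 (kernel_apply (K k.+1 (t k.+1)) (fun=> 1)) w = 1.
Proof.
move=> kn; rewrite /resampled; under eq_bigr do rewrite kernel_apply_cst mulr1.
by rewrite divff// gt_eqF// total_weight_gt0.
Qed.

Let xi_measurableS k i : (k < n)%N -> measurable_fun [set: Omega] (xi k.+1 i).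
Proof. by move=> kn; exact: (xi_measurable xi_system). Qed.

Lemma mean_nuS k f : (k < n)%N -> bounded_measurable f ->
  \int[P]_w nu k.+1 f w = \int[P]_w nu k (q k.+1 f) w.
Proof.
move=> kn bf; pose m f := resampled k.+1 (kernel_apply (K k.+1 (t k.+1)) f).
have law (h : 'I_N -> E -> R) := @particle_law k _ h kn (past_bounded_phi kn).
have bphi := phi_bounded kn.
rewrite (mean_empirical (m := m) (fun i => xi_measurableS i kn) bphi _ law)//.
  by apply: eq_Rintegral => w _; rewrite phi_resampled.
by move=> w; exact: resampled_kernel1.
Qed.

(** The weight is now [phi k.+1 ^+ 2]. The diagonal term absorbs only one factor [phi] into [nu k];
    the other becomes [nu k (gbar k.+1)]. *)
Lemma mean_sqr_nuS k f : (k < n)%N -> bounded_measurable f ->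
  N%:R * \int[P]_w (nu k.+1 f w ^+ 2) =
  \int[P]_w (nu k (gbar k.+1) w * nu k (q k.+1 (fun x => f x ^+ 2)) w) +
  (N%:R - 1) * \int[P]_w (nu k (q k.+1 f) w ^+ 2).
Proof.
move=> kn bf; pose m f := resampled k.+1 (kernel_apply (K k.+1 (t k.+1)) f).
pose Z w := phi k.+1 w ^+ 2.
have bZ : bounded_measurable Z by exact/bounded_measurableX/phi_bounded.
have law (h : 'I_N -> E -> R) := @particle_law k Z h kn
  (bounded_measurableX 2 (past_bounded_phi kn)).
have m1 w : m (fun=> 1) w = 1 by exact: resampled_kernel1.
have := mean_sqr_empirical (m := m) (fun i => xi_measurableS i kn) bZ m1 law
  N_gt0 bf.
have -> : \int[P]_w (Z w * (N%:R^-1 * \sum_i f (xi k.+1 i w)) ^+ 2) =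
    \int[P]_w (nu k.+1 f w ^+ 2).
  by apply: eq_Rintegral => w _; rewrite /Z -exprMn.
move=> ->; congr (_ + _ * _).
  apply: eq_Rintegral => w _; rewrite -(phi_resampled _ w kn) -phiS.
  by rewrite /Z expr2 mulrA.
by apply: eq_Rintegral => w _; rewrite -(phi_resampled _ w kn) [RHS]exprMn.
Qed.

(** The factors [1] give the law the shape required of conditionally i.i.d. variables, with trivial
    weight. *)
Lemma initial_law (f : 'I_N -> E -> R) : (forall i, bounded_measurable (f i)) ->
  \int[P]_w (1 * \prod_i f i (xi 0 i w)) =
  \int[P]_w (1 * \prod_(i < N) \int[mu 0]_x f i x).
Proof.
move=> bf; have mxi i : measurable_fun [set: Omega] (xi 0 i).
  exact: (xi_measurable xi_system).
have := @mean_prod_operator_ext R _ _ Omega E P N (xi 0)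
  (fun _ _ => mu 0) (fun _ h _ => \int[mu 0]_x h x) [set: Omega] mxi.
rewrite indicT => H; apply: H => //.
- move=> _; split=> [h bh|h h' bh bh'|c h bh|h M bh hM w].
  + exact: bounded_measurable_cst.
  + by apply/funext => w; rewrite meanD.
  + by apply/funext => w; rewrite meanZ.
  + exact: norm_mean_le.
- by move=> i w B mB; rewrite mean_indic// fineK// fin_num_measure.
move=> B mB; rewrite setTI (xi_initial xi_system)// integral_cst//.
rewrite [X in (_ * X)%E](_ : _ = 1%E) ?mule1//.
exact: probability_setT.
Qed.

Lemma nu0 f w : nu 0 f w = Defs.eta xi 0 f w.
Proof. by rewrite /Defs.nu phi0 mul1r. Qed.

Lemma mean_nu0 f : bounded_measurable f ->
  \int[P]_w nu 0 f w = \int[mu 0]_x f x.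
Proof.
move=> bf; have mxi i : measurable_fun [set: Omega] (xi 0 i).
  exact: (xi_measurable xi_system).
have := mean_empirical (m := fun h _ => \int[mu 0]_x h x) mxi
  (bounded_measurable_cst 1) (fun=> mean_cst (mu 0) 1) initial_law N_gt0 bf.
rewrite mul1r mean_cst => <-; apply: eq_Rintegral => w _.
by rewrite nu0 mul1r.
Qed.

Lemma mean_sqr_nu0 f : bounded_measurable f ->
  N%:R * \int[P]_w (nu 0 f w ^+ 2) =
  \int[mu 0]_x (f x ^+ 2) + (N%:R - 1) * (\int[mu 0]_x f x) ^+ 2.
Proof.
move=> bf; have mxi i : measurable_fun [set: Omega] (xi 0 i).
  exact: (xi_measurable xi_system).
have := mean_sqr_empirical (m := fun h _ => \int[mu 0]_x h x) mxi
  (bounded_measurable_cst 1) (fun=> mean_cst (mu 0) 1) initial_law N_gt0 bf.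
rewrite !mul1r !mean_cst => <-; congr (_ * _); apply: eq_Rintegral => w _.
by rewrite nu0 mul1r.
Qed.

(** Unbiasedness: going back one generation replaces [f] by its image under [q], which has the same
    mean. *)
Lemma mean_nu k f : (k <= n)%N -> bounded_measurable f ->
  \int[P]_w nu k f w = \int[mu k]_x f x.
Proof.
elim: k f => [|k IH] f kn bf; first exact: mean_nu0.
rewrite mean_nuS// IH ?(ltnW kn)//; last exact: bounded_measurable_q.
exact: (@mean_q k.+1).
Qed.

(** * Variances and covariances of [nu] *)

Definition variance k f : R := \int[P]_w ((nu k f w - \int[mu k]_x f x) ^+ 2).

Lemma mse_variance k f : (k <= n)%N -> bounded_measurable f ->
  mse mu g K t P xi k f = (variance k f)%:E.
Proof.
move=> kn bf; rewrite /mse unlock -EFin_mean.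
  by apply: eq_integral => w _; rewrite real_normK ?num_real.
apply/bounded_measurableX/bounded_measurableB/bounded_measurable_cst.
exact: bounded_measurable_nu.
Qed.

Lemma variance_ge0 k f : 0 <= variance k f.
Proof. by apply: mean_ge0 => w; exact: sqr_ge0. Qed.

Lemma varianceE k f : (k <= n)%N -> bounded_measurable f ->
  variance k f = \int[P]_w (nu k f w ^+ 2) - (\int[mu k]_x f x) ^+ 2.
Proof.
move=> kn bf; rewrite /variance -mean_nu// variance_mean//.
exact: bounded_measurable_nu.
Qed.

Lemma varianceZ k c f : (k <= n)%N -> bounded_measurable f ->
  variance k (fun x => c * f x) = c ^+ 2 * variance k f.
Proof.
move=> kn bf; rewrite /variance -meanZ; last first.
  apply/bounded_measurableX/bounded_measurableB/bounded_measurable_cst.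
  exact: bounded_measurable_nu.
apply: eq_Rintegral => w _; rewrite meanZ// -exprMn; congr (_ ^+ 2).
rewrite /Defs.nu /Defs.eta -mulr_sumr; ring.
Qed.

(** By unbiasedness the left-hand side is a squared covariance, so this is the Cauchy-Schwarz
    inequality. *)
Lemma sqr_mean_nuM_le k f h : (k <= n)%N ->
  bounded_measurable f -> bounded_measurable h ->
  (\int[P]_w (nu k f w * nu k h w) - \int[mu k]_x f x * \int[mu k]_x h x) ^+ 2
  <= variance k f * variance k h.
Proof.
move=> kn bf bh; set a := \int[mu k]_x f x; set b := \int[mu k]_x h x.
have bnf := bounded_measurable_nu kn bf; have bnh := bounded_measurable_nu kn bh.
have bfa : bounded_measurable (fun w => nu k f w - a) by bounded_measurability.
have bhb : bounded_measurable (fun w => nu k h w - b) by bounded_measurability.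
have := Cauchy_Schwarz_mean P bfa bhb; congr (_ ^+ 2 <= _).
transitivity (\int[P]_w ((nu k f w * nu k h w - b * nu k f w) -
    a * (nu k h w - b))).
  by apply: eq_Rintegral => w _; ring.
by rewrite !(meanB, meanZ, mean_nu, mean_cst)//;
  [rewrite -/a -/b; ring|bounded_measurability..].
Qed.

Lemma variance0_le f : bounded_measurable f ->
  N%:R * variance 0 f <= \int[mu 0]_x (f x ^+ 2).
Proof.
move=> bf; rewrite varianceE// mulrBr mean_sqr_nu0//.
by have := sqr_ge0 (\int[mu 0]_x f x); lra.
Qed.

(** Here [c] bounds the covariance of [nu k (gbar k.+1)] and [nu k (q k.+1 (f^2))]; assuming its
    square avoids square roots. The remaining [- E[nu k (q k.+1 f)^2]] is dropped. *)
Lemma varianceS_le k f (c : R) : (k < n)%N -> bounded_measurable f -> 0 <= c ->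
  variance k (gbar k.+1) * variance k (q k.+1 (fun x => f x ^+ 2)) <= c ^+ 2 ->
  N%:R * variance k.+1 f <=
  N%:R * variance k (q k.+1 f) + c + \int[mu k.+1]_x (f x ^+ 2).
Proof.
move=> kn bf c0 vc; have kn' := ltnW kn.
have bf2 := bounded_measurableX 2 bf.
have bq := @bounded_measurable_q k.+1 _ kn bf.
have bq2 := @bounded_measurable_q k.+1 _ kn bf2.
have bg := @bounded_measurable_gbar k.+1 kn.
have := le_trans (sqr_mean_nuM_le kn' bg bq2) vc.
have -> : \int[mu k]_x gbar k.+1 x = 1.
  rewrite -[RHS](mean_cst (mu k.+1)) -(@mean_gbar k.+1)//.
    by apply: eq_Rintegral => x _; rewrite mulr1.
  exact: bounded_measurable_cst.
rewrite mul1r (@mean_q k.+1)// => h.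
rewrite !varianceE// (@mean_q k.+1)// mulrBr mean_sqr_nuS//.
have {h} : \int[P]_w (nu k (gbar k.+1) w * nu k (q k.+1 (fun x => f x ^+ 2)) w)
    - \int[mu k.+1]_x (f x ^+ 2) <= c.
  rewrite (le_trans (ler_norm _))// -(ger0_norm c0).
  by rewrite -ler_sqr ?nnegrE// !real_normK ?num_real.
have : 0 <= \int[P]_w (nu k (q k.+1 f) w ^+ 2).
  by apply: mean_ge0 => w; exact: sqr_ge0.
lra.
Qed.

Context (gamma : R).
Hypothesis gbar_le : forall k, (1 <= k <= n)%N -> forall x, gbar k x <= gamma.

Lemma phi_bounds k w : (k <= n)%N -> 0 <= phi k w <= gamma ^+ k.
Proof.
elim: k => [|k IH] kn; first by rewrite phi0 expr0 ler01 lexx.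
have /andP[p0 pg] := IH (ltnW kn).
have N_neq0 : N%:R != 0 :> R by rewrite pnatr_eq0 -lt0n.
have e0 : 0 <= Defs.eta xi k (gbar k.+1) w.
  rewrite mulr_ge0 ?invr_ge0 ?ler0n//; apply: sumr_ge0 => i _.
  by apply/ltW/gbar_gt0.
have eg : Defs.eta xi k (gbar k.+1) w <= gamma.
  rewrite /Defs.eta mulrC ler_pdivrMr ?ltr0n//.
  apply: (@le_trans _ _ (\sum_(i < N) gamma)).
    by apply: ler_sum => i _; exact: gbar_le.
  by rewrite sumr_const card_ord mulr_natr.
by rewrite phiS exprSr mulr_ge0//= ler_pM.
Qed.

(** Jensen's inequality for the empirical measure and [phi^2 <= gamma^k phi] give
    [nu(f)^2 <= gamma^k nu(f^2)]; unbiasedness does the rest. This crude bound makes [eps_bar]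
    finite. *)
Lemma variance_le k f : (k <= n)%N -> bounded_measurable f ->
  variance k f <= gamma ^+ k * \int[mu k]_x (f x ^+ 2).
Proof.
move=> kn bf; have bf2 := bounded_measurableX 2 bf.
have bnf := bounded_measurable_nu kn bf.
have bnf2 := bounded_measurable_nu kn bf2.
apply: (@le_trans _ _ (\int[P]_w (nu k f w ^+ 2))).
  by rewrite varianceE// gerBl sqr_ge0.
rewrite -mean_nu// -meanZ//.
apply: le_mean; [bounded_measurability..|move=> w].
have /andP[p0 pg] := phi_bounds w kn.
have N0 : 0 < N%:R :> R by rewrite ltr0n.
have jensen : Defs.eta xi k f w ^+ 2 <= Defs.eta xi k (fun x => f x ^+ 2) w.
  rewrite /Defs.eta; set S := \sum_(i < N) f (xi k i w).
  have : 0 <= \sum_(i < N) (f (xi k i w) - N%:R^-1 * S) ^+ 2.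
    by apply: sumr_ge0 => i _; exact: sqr_ge0.
  have -> : \sum_(i < N) (f (xi k i w) - N%:R^-1 * S) ^+ 2 =
      \sum_(i < N) f (xi k i w) ^+ 2 - N%:R * (N%:R^-1 * S) ^+ 2.
    transitivity (\sum_(i < N) ((f (xi k i w) ^+ 2 -
        2 * (N%:R^-1 * S) * f (xi k i w)) + (N%:R^-1 * S) ^+ 2)).
      by apply: eq_bigr => i _; ring.
    rewrite big_split/= sumrB -mulr_sumr -/S sumr_const card_ord.
    rewrite -[X in _ + X = _]mulr_natl; field.
    by rewrite gt_eqF.
  by rewrite subr_ge0 -ler_pdivlMl.
rewrite /Defs.nu exprMn [in leLHS]expr2 -mulrA ler_pM//.
  by rewrite mulr_ge0// sqr_ge0.
by rewrite ler_wpM2l.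
Qed.

(** * Stability of dyadic moments under [q] *)

Context (tau : R) (s : nat) (delta : nat -> R).
Hypothesis gamma_ge1 : 1 <= gamma.
Let gamma_ge0 : 0 <= gamma := le_trans ler01 gamma_ge1.
Hypothesis tau_gt0 : 0 < tau.
Hypothesis tau_le1 : tau <= 1.
Hypothesis s_gt0 : (0 < s)%N.
Hypothesis delta_ge0 : forall k, (1 <= k <= n)%N -> 0 <= delta k.
Hypothesis delta_le : forall k, (1 <= k <= n)%N ->
  gamma ^+ (2 ^ s).-1 * delta k <= 1 - tau.
Hypothesis K_gap : forall k, (1 <= k <= n)%N ->
  forall f, bounded_measurable f ->
  \int[mu k]_x ((kernel_apply (K k (t k)) f x - \int[mu k]_y f y) ^+ 2) <=
  delta k * \int[mu k]_x ((f x - \int[mu k]_y f y) ^+ 2).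
Hypothesis K_hyper : forall k, (1 <= k <= n)%N ->
  forall f, bounded_measurable f ->
  \int[mu k]_x (kernel_apply (K k (t k)) (fun y => f y ^+ 2) x ^+ (2 ^ s)) <=
  (\int[mu k]_x (f x ^+ (2 ^ s))) ^+ 2.

(* The solution of [c (r + 1) = gamma ^ (2 ^ (r + 1) - 1) / tau * c r ^ 2] with
   [c 0 = 1]. *)
Definition moment_const r : R :=
  gamma ^+ ((r * 2 ^ r).+1 - 2 ^ r) * tau^-1 ^+ (2 ^ r).-1.

Lemma moment_constS r :
  moment_const r.+1 * tau = gamma ^+ (2 ^ r.+1).-1 * moment_const r ^+ 2.
Proof.
have m0 : (0 < 2 ^ r)%N by rewrite expn_gt0.
rewrite /moment_const exprMn -!exprM mulrA -exprD -mulrA; congr (gamma ^+ _ * _).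
  (* Keeps the natural subtraction in [moment_const] from truncating. *)
  have rm : (2 ^ r <= (r * 2 ^ r).+1)%N.
    by case: (r) => // r'; rewrite leqW// leq_pmull.
  rewrite expnS mulSn; move: rm m0; move: (2 ^ r)%N => m rm m0.
  rewrite mulnCA; move: (r * m)%N rm => rm' rm; lia.
have -> : (2 ^ r.+1).-1 = ((2 ^ r).-1 * 2).+1.
  by rewrite expnS; move: (2 ^ r)%N m0 => m m0; lia.
by rewrite exprS mulrAC mulVf ?mul1r// gt_eqF.
Qed.

(** The power of [gamma] coming from a weight completes the exponent to a multiple of [2 ^ r], ready
    for the root of that order. *)
Lemma moment_constE r : gamma ^+ (2 ^ r).-1 * moment_const r =
  gamma ^+ (r * 2 ^ r) * tau^-1 ^+ (2 ^ r).-1.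
Proof.
have m0 : (0 < 2 ^ r)%N by rewrite expn_gt0.
rewrite /moment_const mulrA -exprD; congr (gamma ^+ _ * _).
have rm : (2 ^ r <= (r * 2 ^ r).+1)%N.
  by case: (r) => // r'; rewrite leqW// leq_pmull.
by move: rm m0; move: (r * 2 ^ r)%N (2 ^ r)%N => x y; lia.
Qed.

Lemma moment_const_ge1 r : 1 <= moment_const r.
Proof. by rewrite mulr_ege1// exprn_ege1// invf_ge1. Qed.

Lemma moment_const1 : moment_const 1 = gamma / tau.
Proof. by rewrite /moment_const !expr1. Qed.

(** The class that [q] carries from generation [k.+1] to [k] with the same [F]. The absolute value
    matters only at [r = 0], where the power is odd. *)
Definition stable_moments k (F : R) f := bounded_measurable f /\
  forall r, (r <= s)%N ->
    `|\int[mu k]_x (f x ^+ (2 ^ r))| <= moment_const r * F ^+ (2 ^ r).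

(** Monotonicity of dyadic norms, descending from [s] by one square at a time. *)
Lemma mean_exp2_le k (F : R) f r : 0 <= F -> bounded_measurable f ->
  \int[mu k]_x (f x ^+ (2 ^ s)) <= F ^+ (2 ^ s) -> (r <= s)%N ->
  `|\int[mu k]_x (f x ^+ (2 ^ r))| <= F ^+ (2 ^ r).
Proof.
move=> F0 bf fF rs; rewrite -(subKn rs).
elim: (s - r)%N (leq_subr r s) => [|j IH] js.
  rewrite subn0 ger0_norm//; apply: mean_ge0 => x.
  by rewrite exprn_even_ge0// -(prednK s_gt0) odd_2X.
have := IH (ltnW js); rewrite -(subnSK js) => /(le_trans (ler_norm _)) {}IH.
rewrite -ler_sqr ?nnegrE ?exprn_ge0// real_normK ?num_real//.
rewrite (le_trans (sqr_mean_le _ (bounded_measurableX _ bf)))//.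
by under eq_Rintegral do rewrite -exprM -expnSr; rewrite -exprM -expnSr.
Qed.

Lemma stable_moments_of_norm k F f : 0 <= F -> bounded_measurable f ->
  \int[mu k]_x (f x ^+ (2 ^ s)) <= F ^+ (2 ^ s) -> stable_moments k F f.
Proof.
move=> F0 bf fF; split=> // r rs; apply: le_trans (mean_exp2_le F0 bf fF rs) _.
by rewrite ler_peMl ?exprn_ge0// moment_const_ge1.
Qed.

(** At [r = 0] the mean is preserved. At higher powers the running time gives the old moment a
    coefficient of at most [1 - tau], and [moment_constS] fits the squared lower moment into the
    share [tau]. *)
Lemma stable_moments_q k F f : (k < n)%N -> 0 <= F ->
  stable_moments k.+1 F f -> stable_moments k F (q k.+1 f).
Proof.
move=> kn F0 [bf fr]; split; first exact: bounded_measurable_q.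
case=> [|r] rs.
  have := fr 0%N rs; rewrite !expr1.
  under eq_Rintegral do rewrite expr1.
  under [in X in _ -> X]eq_Rintegral do rewrite expr1.
  by rewrite (@mean_q k.+1).
rewrite ger0_norm; last by apply: mean_ge0 => x; rewrite exprn_even_ge0// odd_2X.
have density h : bounded_measurable h ->
    \int[mu k]_x (gbar k.+1 x * h x) = \int[mu k.+1]_x h x.
  exact: (@mean_gbar k.+1).
have := mean_moment_le (@bounded_measurable_gbar k.+1 kn)
  (fun x => ltW (@gbar_gt0 k.+1 x kn)) (@gbar_le k.+1 kn) density
  (@K_stationary k.+1 kn) (@delta_ge0 k.+1 kn) (@K_gap k.+1 kn) r bf.
move=> /le_trans; apply.
have := fr _ rs; have := fr _ (ltnW rs).
set a := \int[mu k.+1]_x _; set b := \int[mu k.+1]_x _ => ha hb.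
have hb' : b <= moment_const r.+1 * F ^+ (2 ^ r.+1).
  exact: le_trans (ler_norm _) hb.
have ha2 : a ^+ 2 <= moment_const r ^+ 2 * F ^+ (2 ^ r.+1).
  rewrite expnSr exprM -exprMn -(real_normK (num_real a)) ler_sqr ?nnegrE//.
  by rewrite (le_trans _ ha).
have b0 : 0 <= b by apply: mean_ge0 => x; rewrite exprn_even_ge0// odd_2X.
rewrite mulrDr; set Fr := F ^+ _ in hb' ha2 *.
(* As [gamma >= 1], the assumption for the top power [2 ^ s] covers all lower ones. *)
have gd : gamma ^+ (2 ^ r.+1).-1 * delta k.+1 <= 1 - tau.
  apply: le_trans (@delta_le k.+1 kn); rewrite ler_wpM2r ?delta_ge0//.
  rewrite ler_weXn2l//; have := leq_pexp2l (isT : (0 < 2)%N) rs.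
  by rewrite -!subn1; exact: leq_sub2r.
have -> : moment_const r.+1 * Fr =
    (1 - tau) * (moment_const r.+1 * Fr) + moment_const r.+1 * tau * Fr by ring.
apply: lerD.
- rewrite mulrA; apply: ler_pM => //.
  by rewrite mulr_ge0 ?exprn_ge0 ?delta_ge0.
- by rewrite moment_constS -mulrA ler_wpM2l// exprn_ge0.
Qed.

(** * Closing the recursion with a worst-case error [e] *)

Context (e : R).
Hypothesis e_ge0 : 0 <= e.
Hypothesis variance_le_norm : forall k (F : R) f, (k <= n)%N -> 0 <= F ->
  bounded_measurable f -> \int[mu k]_x (f x ^+ (2 ^ s)) <= F ^+ (2 ^ s) ->
  variance k f <= e * F ^+ 2.

Lemma root_exp2 (x : R) : 0 <= x -> (x `^ (2 ^ s)%:R^-1) ^+ (2 ^ s) = x.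
Proof.
move=> x0; rewrite -powR_mulrn ?powR_ge0// -powRrM mulVf ?powRr1//.
Qed.

(** Both variances are bounded by [e] times squared L_p bounds, [G] for [gbar k.+1] and [H] for
    [q k.+1 (f^2)]; the latter uses hypercontractivity. The product [G * H] is estimated through its
    power [p]. *)
Lemma variance_weights_le k F f : (k < n)%N -> 0 <= F ->
  stable_moments k.+1 F f ->
  variance k (gbar k.+1) * variance k (q k.+1 (fun x => f x ^+ 2)) <=
  (gamma ^+ (2 * s) * tau ^- 2 * e * F ^+ 2) ^+ 2.
Proof.
move=> kn F0 [bf fr]; set p := (2 ^ s)%N.
have p0 : (0 < p)%N by rewrite expn_gt0.
have p_even : ~~ odd p by rewrite /p -(prednK s_gt0) odd_2X.
have density h : bounded_measurable h ->
    \int[mu k]_x (gbar k.+1 x * h x) = \int[mu k.+1]_x h x.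
  exact: (@mean_gbar k.+1).
have exp_le h : bounded_measurable h ->
    \int[mu k]_x ((gbar k.+1 x * h x) ^+ p) <=
    gamma ^+ p.-1 * \int[mu k.+1]_x (h x ^+ p).
  move=> bh; have := @mean_weight_exp_le _ _ _ _ _ _ _
    (@bounded_measurable_gbar k.+1 kn)
    (fun x => ltW (@gbar_gt0 k.+1 x kn)) (@gbar_le k.+1 kn) density h p.-1 bh.
  rewrite prednK//; apply=> x; exact: exprn_even_ge0.
set A := gamma ^+ p.-1; set B := moment_const s ^+ 2 * F ^+ (2 * p).
have A0 : 0 <= A by rewrite exprn_ge0.
have B0 : 0 <= B by rewrite mulr_ge0 ?sqr_ge0// exprn_ge0.
have AB0 : 0 <= A * B by rewrite mulr_ge0.
pose G := A `^ p%:R^-1; pose H := (A * B) `^ p%:R^-1.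
have vG : variance k (gbar k.+1) <= e * G ^+ 2.
  apply: variance_le_norm; rewrite ?powR_ge0 ?(ltnW kn)//.
    exact: bounded_measurable_gbar.
  rewrite root_exp2//; have := exp_le _ (bounded_measurable_cst 1).
  under eq_Rintegral do rewrite mulr1.
  by under [in X in _ * X]eq_Rintegral do rewrite expr1n; rewrite mean_cst mulr1.
have vH : variance k (q k.+1 (fun x => f x ^+ 2)) <= e * H ^+ 2.
  have bf2 := bounded_measurableX 2 bf.
  apply: variance_le_norm; rewrite ?powR_ge0 ?(ltnW kn)//.
    exact: bounded_measurable_q.
  rewrite (root_exp2 AB0).
  apply: le_trans (exp_le _ (bounded_measurable_kernel _ bf2)) _.
  rewrite ler_wpM2l// (le_trans (K_hyper _ bf))//.
  rewrite /B mulnC exprM -exprMn ler_sqr ?nnegrE.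
  - by have := fr s (leqnn s); exact/le_trans/ler_norm.
  - by apply: mean_ge0 => x; exact: exprn_even_ge0.
  - by rewrite mulr_ge0 ?exprn_ge0// (le_trans ler01)// moment_const_ge1.
have GH : G * H <= gamma ^+ (2 * s) * tau ^- 2 * F ^+ 2.
  have rhs0 : 0 <= gamma ^+ (2 * s) * tau ^- 2 * F ^+ 2.
    by rewrite !mulr_ge0 ?invr_ge0 ?exprn_ge0// ltW.
  rewrite -(@ler_pXn2r _ p)// ?nnegrE; last by rewrite mulr_ge0 ?powR_ge0.
  rewrite exprMn (root_exp2 A0) (root_exp2 AB0).
  have -> : A * (A * B) = (A * moment_const s) ^+ 2 * F ^+ (2 * p).
    by rewrite /B; ring.
  rewrite [leRHS]exprMn -(exprM F) ler_wpM2r ?exprn_ge0//.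
  rewrite moment_constE -/p -exprVn [leLHS]exprMn [leRHS]exprMn -!exprM.
  have -> : (s * p * 2 = 2 * s * p)%N by clear; lia.
  apply: ler_wpM2l; first exact: exprn_ge0.
  (* The exponent [2 (p - 1)] of [tau^-1] is enlarged to [2 p], whose root of order [p] is
     [tau ^- 2]. *)
  have tauV_ge1 : 1 <= tau^-1 by rewrite invf_ge1.
  apply: ler_weXn2l => //.
  by rewrite mulnC leq_mul2l leq_pred.
apply: (@le_trans _ _ ((e * G ^+ 2) * (e * H ^+ 2))).
  by apply: ler_pM => //; exact: variance_ge0.
have -> : e * G ^+ 2 * (e * H ^+ 2) = (e * (G * H)) ^+ 2 by ring.
have eGH : e * (G * H) <= gamma ^+ (2 * s) * tau ^- 2 * e * F ^+ 2.
  by rewrite mulrAC [leRHS]mulrC ler_wpM2l.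
have eGH0 : 0 <= e * (G * H) by rewrite mulr_ge0// mulr_ge0 ?powR_ge0.
by rewrite ler_sqr ?nnegrE// (le_trans eGH0).
Qed.

(** Each step back adds one covariance bound and turns the second moment of [f] into that of its
    image under [q], at most [gamma / tau * F ^+ 2]. The second moment at the top stays explicit, as
    it is at most [F ^+ 2] on the ball. *)
Lemma variance_stable_le k F f : (k <= n)%N -> 0 <= F -> stable_moments k F f ->
  N%:R * variance k f <= \int[mu k]_x (f x ^+ 2) +
    k%:R * (gamma / tau * F ^+ 2 + gamma ^+ (2 * s) * tau ^- 2 * e * F ^+ 2).
Proof.
set c := gamma ^+ (2 * s) * tau ^- 2 * e * F ^+ 2.
move=> + F0; elim: k f => [|k IH] f kn fS.
  by rewrite mul0r addr0 variance0_le//; case: fS.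
have c0 : 0 <= c.
  by rewrite !mulr_ge0// ?exprn_ge0 ?invr_ge0 ?exprn_ge0// ltW.
have := varianceS_le kn fS.1 c0 (variance_weights_le kn F0 fS).
have qS := stable_moments_q kn F0 fS; have := IH _ (ltnW kn) qS.
have := qS.2 1%N s_gt0; rewrite moment_const1 => /(le_trans (ler_norm _)).
rewrite -[k.+1]addn1 natrD.
by set x := \int[mu k]_x _; set y := \int[mu (k + 1)]_x _; lra.
Qed.

Lemma variance_norm_le k (F : R) f :
  (k <= n)%N -> 0 <= F -> bounded_measurable f ->
  \int[mu k]_x (f x ^+ (2 ^ s)) <= F ^+ (2 ^ s) ->
  N%:R * variance k f <= F ^+ 2 *
    (1 + k%:R * gamma / tau + k%:R * (gamma ^+ (2 * s) * tau ^- 2) * e).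
Proof.
move=> kn F0 bf fF.
have := variance_stable_le kn F0 (stable_moments_of_norm F0 bf fF).
have := mean_exp2_le F0 bf fF s_gt0 => /(le_trans (ler_norm _)).
by set x := \int[mu k]_x _; lra.
Qed.

End particle_moments.

(** * Norm and running-time assumptions in terms of moments *)

Lemma Lnorm2_sqr {R : realType} {d} {T : measurableType d}
    (mu : probability T R) (f : T -> R) : bounded_measurable f ->
  (('N[mu]_2%:E[EFin \o f]) ^+ 2)%E = (\int[mu]_x (f x ^+ 2))%:E.
Proof.
move=> bf; rewrite (@Lnorm_even _ _ _ mu 2)// -EFin_expe; congr EFin.
rewrite -powR_mulrn ?powR_ge0// -powRrM mulVf ?powRr1 ?pnatr_eq0//.
by apply: mean_ge0 => x; exact: sqr_ge0.
Qed.

(** With [p = 2 ^ s], the chain is [||h||_p <= ||h||_q <= ||f^2||_(p/2) = ||f||_p^2], raised to the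
    power [p]. It is meant for [h] the image of [f^2] under the kernel. *)
Lemma mean_exp2_le_of_Lnorm {R : realType} {d} {T : measurableType d}
    (mu : probability T R) (f h : T -> R) (s : nat) (q : R) : (2 <= s)%N ->
  bounded_measurable f -> bounded_measurable h -> (2 ^ s)%:R <= q ->
  ('N[mu]_q%:E[EFin \o h] <=
   'N[mu]_((2 ^ s.-1)%:R)%:E[EFin \o (fun x => f x ^+ 2)%R])%E ->
  \int[mu]_x (h x ^+ (2 ^ s)) <= (\int[mu]_x (f x ^+ (2 ^ s))) ^+ 2.
Proof.
case: s => [//|[//|s]] _ bf bh sq /=.
have bf2 := bounded_measurableX 2 bf.
have m0 (r : nat) : (0 < 2 ^ r)%N by rewrite expn_gt0.
have m2 (r : nat) : ~~ odd (2 ^ r.+1) by rewrite odd_2X.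
have sq0 : 0 < (2 ^ s.+2)%:R :> R by rewrite ltr0n.
move=> /(le_trans (le_Lnorm mu sq0 sq bh)).
rewrite (Lnorm_even mu (m0 s.+1) (m2 s) bf2); set I := \int[mu]_x _.
have I0 : 0 <= I by apply: mean_ge0 => x; rewrite exprn_even_ge0.
have IE : \int[mu]_x (f x ^+ (2 ^ s.+2)) = I.
  by apply: eq_Rintegral => x _; rewrite -exprM -expnS.
rewrite (Lnorm_even_le mu (m0 s.+2) (m2 s.+1) (powR_ge0 _ _) bh) IE.
move=> /le_trans; apply; rewrite [(2 ^ s.+2)%N]expnSr exprM.
have -> // : (I `^ (2 ^ s.+1)%:R^-1) ^+ (2 ^ s.+1) = I.
rewrite -powR_mulrn ?powR_ge0// -powRrM mulVf ?powRr1//.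
Qed.

Lemma exp_gap_le {R : realType} (gamma tau b t : R) (m : nat) :
  (0 < m)%N -> 1 <= gamma -> 0 < tau < 1 -> 0 < b ->
  (2 * b)^-1 * ((2 * m%:R - 1) * ln gamma - ln (1 - tau)) <= t ->
  gamma ^+ m.-1 * expR (- (2 * b * t)) <= 1 - tau.
Proof.
move=> m0 gamma1 /andP[tau0 tau1] b0 bt.
have gamma0 : 0 < gamma := lt_le_trans ltr01 gamma1.
have b20 : 0 < 2 * b by rewrite mulr_gt0.
have tau1' : 0 < 1 - tau by rewrite subr_gt0.
move: bt; rewrite ler_pdivrMl// => bt.
have -> : gamma ^+ m.-1 = expR (m.-1%:R * ln gamma).
  by rewrite mulr_natl -lnXn// lnK// posrE exprn_gt0.
rewrite -expRD -[leRHS]lnK ?posrE// ler_expR.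
have mE : m%:R = m.-1%:R + 1 :> R by rewrite -[in LHS](prednK m0) mulrSr.
have lg0 : 0 <= ln gamma by rewrite ln_ge0.
(* The exponents [2 m - 1] and [m - 1] of [gamma] differ by [m], and [m ln gamma] is nonnegative. *)
have : 0 <= (m.-1%:R + 1) * ln gamma :> R by rewrite mulr_ge0// -mE ler0n.
by rewrite mE in bt *; lra.
Qed.

(** The running time is long enough for hypercontractivity to lift the exponent [p / 2] to at least
    [p]. *)
Lemma hyper_exponent_ge {R : realType} (p a t : R) : 2 < p -> 0 < a ->
  (2 * a)^-1 * (ln (p - 1) - ln (p / 2 - 1)) <= t ->
  p <= 1 + (p / 2 - 1) * expR (2 * a * t).
Proof.
move=> p2 a0; rewrite ler_pdivrMl ?mulr_gt0// => h.
have p1 : 0 < p - 1 by lra.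
have p21 : 0 < p / 2 - 1 by lra.
rewrite -lerBlDl -ler_pdivrMl// -[leLHS]lnK ?posrE ?mulr_gt0 ?invr_gt0//.
by rewrite ler_expR lnM ?posrE ?invr_gt0// lnV ?posrE// addrC.
Qed.

Theorem corollary5p6 (R : realType) (E : ptopologicalType)
  (hE : polish R E)
  (n : nat) (hn : (0 < n)%N)
  (mu : nat -> probability (borel E) R)
  (g : nat -> borel E -> R)
  (K : nat -> R -> R.-pker (borel E) ~> (borel E))
  (t : nat -> R)
  (ht : forall k, (1 <= k <= n)%N -> 0 < t k)
  (hK : forall k, (1 <= k <= n)%N -> stationary (mu k) (K k (t k)))
  (hg : forall k, (1 <= k <= n)%N -> bounded_measurable (g k))
  (hg0 : forall k, (1 <= k <= n)%N -> forall x, 0 < g k x)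
  (hmu : forall k, (1 <= k <= n)%N -> forall f : borel E -> R, bounded_measurable f ->
     \int[mu k]_x f x =
     (\int[mu k.-1]_x (g k x * f x)) / (\int[mu k.-1]_x g k x))
  (N : nat) (hN : (1 <= N)%N)
  (dO : measure_display) (Omega : measurableType dO) (P : probability Omega R)
  (xi xihat : nat -> 'I_N -> Omega -> borel E)
  (hxi : is_particle_system mu g K t P xi xihat n)
  (tau : R) (htau : 0 < tau < 1)
  (s : nat) (hs : (2 <= s)%N)
  (p : R) (hp : p = 2 ^+ s)
  (gamma : R) (hgamma : 1 < gamma)
  (hgbar : forall k, (1 <= k <= n)%N -> forall x, gbar mu g k x <= gamma)
  (a b : nat -> R)
  (ha : forall k, (1 <= k <= n)%N -> 0 < a k)
  (hb : forall k, (1 <= k <= n)%N -> 0 < b k)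
  (hyper : forall k, (1 <= k <= n)%N -> forall f : borel E -> R, bounded_measurable f ->
     forall p' : R, 1 < p' ->
     ('N[mu k]_(1 + (p' - 1) * expR (2 * a k * t k))%:E
        [EFin \o kernel_apply (K k (t k)) f]
      <= 'N[mu k]_p'%:E[EFin \o f])%E)
  (gap : forall k, (1 <= k <= n)%N -> forall f : borel E -> R, bounded_measurable f ->
     (('N[mu k]_2%:E
         [EFin \o (fun x => kernel_apply (K k (t k)) f x - \int[mu k]_y f y)%R])
        ^+ 2
      <= (expR (- (2 * b k * t k)))%:E *
         ('N[mu k]_2%:E[EFin \o (fun x => f x - \int[mu k]_y f y)%R]) ^+ 2)%E)
  (htb : forall l, (1 <= l <= n)%N ->
     t l >= (2 * b l)^-1 * ((2 * p - 1) * ln gamma - ln (1 - tau)))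
  (hta : forall l, (1 <= l <= n)%N ->
     t l >= (2 * a l)^-1 * (ln (p - 1) - ln (p / 2 - 1))) :
  (forall f : borel E -> R, bounded_measurable f ->
     (N%:R%:E * mse mu g K t P xi n f <=
      ('N[mu n]_p%:E[EFin \o f]) ^+ 2 *
      ((1 + n%:R * gamma * tau ^- 2)%:E +
       (n%:R * Num.max (1 + gamma) 3 * gamma `^ (2 * s%:R + p^-1) * tau ^- 2)%:E
       * eps_bar mu g K t P xi n p))%E) /\
  (2 * Num.max (1 + gamma) 3 * n%:R * gamma `^ (2 * s%:R + p^-1) * tau ^- 2
     <= N%:R ->
   (eps_bar mu g K t P xi n p
      <= (2 * ((1 + n%:R * gamma * tau ^- 2) / N%:R))%:E)%E).
Proof.
have s0 : (0 < s)%N := ltnW hs.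
have gamma1 : 1 <= gamma := ltW hgamma.
have gamma0 : 0 < gamma := lt_trans ltr01 hgamma.
have /andP[tau0 /ltW tau1] := htau.
have {hp}pE : p = (2 ^ s)%:R by rewrite hp natrX.
have m0 : (0 < 2 ^ s)%N by rewrite expn_gt0.
have m2 : ~~ odd (2 ^ s) by rewrite -(prednK s0) odd_2X.
have p2 : 2 < p.
  by rewrite pE ltr_nat; apply: leq_trans (leq_pexp2l _ hs).
have p_half : p / 2 = (2 ^ s.-1)%:R.
  by rewrite pE -[in LHS](prednK s0) expnSr natrM mulfK.
pose delta k := expR (- (2 * b k * t k)).
have delta_ge0 k : (1 <= k <= n)%N -> 0 <= delta k by rewrite expR_ge0.
have delta_le k : (1 <= k <= n)%N -> gamma ^+ (2 ^ s).-1 * delta k <= 1 - tau.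
  move=> kn; apply: (exp_gap_le m0 gamma1 htau (hb _ kn)).
  by rewrite -pE; exact: htb.
have K_gap k : (1 <= k <= n)%N ->
    forall f : borel E -> R, bounded_measurable f ->
    \int[mu k]_x ((kernel_apply (K k (t k)) f x - \int[mu k]_y f y) ^+ 2) <=
    delta k * \int[mu k]_x ((f x - \int[mu k]_y f y) ^+ 2).
  move=> kn f bf; have := gap _ kn _ bf.
  have bc := @bounded_measurable_cst R _ (borel E) (\int[mu k]_y f y).
  rewrite (Lnorm2_sqr (mu k) (bounded_measurableB bf bc)).
  rewrite (Lnorm2_sqr (mu k)
    (bounded_measurableB (bounded_measurable_kernel (K k (t k)) bf) bc)).
  by rewrite -EFinM lee_fin.
have K_hyper k : (1 <= k <= n)%N ->
    forall f : borel E -> R, bounded_measurable f ->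
    \int[mu k]_x (kernel_apply (K k (t k)) (fun y => f y ^+ 2) x ^+ (2 ^ s)) <=
    (\int[mu k]_x (f x ^+ (2 ^ s))) ^+ 2.
  move=> kn f bf; have bf2 := bounded_measurableX 2 bf.
  have p1 : 1 < p / 2 by lra.
  have := hyper _ kn _ bf2 _ p1; rewrite p_half.
  apply: mean_exp2_le_of_Lnorm => //; first exact: bounded_measurable_kernel.
  by rewrite -p_half -pE; apply: hyper_exponent_ge => //; [exact: ha|exact: hta].
have mseE k f : (k <= n)%N -> bounded_measurable f ->
    mse mu g K t P xi k f = (variance mu g K t P xi k f)%:E.
  exact: (mse_variance hg hxi).
have Lnorm_le k (f : borel E -> R) (F : R) : bounded_measurable f -> 0 <= F ->
    ('N[mu k]_p%:E[EFin \o f] <= F%:E)%E =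
    (\int[mu k]_x (f x ^+ (2 ^ s)) <= F ^+ (2 ^ s)).
  by move=> bf F0; rewrite pE; exact: Lnorm_even_le.
have var_le k (F : R) f : (k <= n)%N -> 0 <= F -> bounded_measurable f ->
    \int[mu k]_x (f x ^+ (2 ^ s)) <= F ^+ (2 ^ s) ->
    variance mu g K t P xi k f <= gamma ^+ n * F ^+ 2.
  move=> kn F0 bf fF.
  apply: le_trans (variance_le hg hg0 hmu hK hN hxi hgbar kn bf) _.
  have := mean_exp2_le s0 F0 bf fF s0 => /(le_trans (ler_norm _)) fF2.
  apply: ler_pM fF2; first by rewrite exprn_ge0// ltW.
    by apply: mean_ge0 => x; exact: sqr_ge0.
  by rewrite ler_weXn2l.
set ball := fun j : 'I_n.+1 => [set f : borel E -> R | bounded_measurable f /\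
  ('N[mu j]_p%:E[EFin \o f] <= 1)%E].
have eps_le (c : R) : (forall j : 'I_n.+1, forall f, ball j f ->
    variance mu g K t P xi j f <= c) -> (eps_bar mu g K t P xi n p <= c%:E)%E.
  move=> jc; apply: bigmax_le => [|j _]; first exact: leNye.
  apply: ge_ereal_sup => _ [f fj <-]; rewrite mseE ?lee_fin ?jc//.
    by rewrite -ltnS.
  by case: fj.
have eps_ge j f : ball j f ->
    ((variance mu g K t P xi j f)%:E <= eps_bar mu g K t P xi n p)%E.
  move=> fj; apply: le_trans (le_bigmax _ _ j); apply: ereal_sup_ubound.
  exists f => //; rewrite mseE//; [by rewrite -ltnS|by case: fj].
(* The zero function makes a supremum nonempty, so [eps_bar] is nonnegative and not [-oo]. *)
have ball0 : ball ord0 (fun=> 0).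
  have b0 := @bounded_measurable_cst R _ (borel E) 0.
  split=> //; rewrite Lnorm_le//; under eq_Rintegral do rewrite expr0n.
  by rewrite mean_cst expr1n gtn_eqF.
have eps_fin : eps_bar mu g K t P xi n p \is a fin_num.
  rewrite fin_numE; apply/andP; split.
    by rewrite -ltNye; apply: lt_le_trans (eps_ge _ _ ball0); rewrite ltNyr.
  rewrite -ltey; apply: (@le_lt_trans _ _ (gamma ^+ n)%:E); last by rewrite ltry.
  apply: eps_le => j f [bf f1]; rewrite -[leRHS]mulr1 -[X in _ * X](expr1n _ 2).
  apply: var_le => //; first by rewrite -ltnS.
  by rewrite -Lnorm_le.
pose e := fine (eps_bar mu g K t P xi n p).
have eE : eps_bar mu g K t P xi n p = e%:E by rewrite fineK.
have e0 : 0 <= e.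
  rewrite -lee_fin -eE; apply: le_trans (eps_ge _ _ ball0).
  by rewrite lee_fin variance_ge0.
have var_e k (F : R) (f : borel E -> R) : (k <= n)%N -> 0 <= F ->
    bounded_measurable f -> \int[mu k]_x (f x ^+ (2 ^ s)) <= F ^+ (2 ^ s) ->
    variance mu g K t P xi k f <= e * F ^+ 2.
  (* For [F > 0] the function is scaled into the unit ball. [F = 0] admits no scaling; there the
     crude bound gives variance zero. *)
  move=> kn; rewrite le_eqVlt => /predU1P[<- bf f0|F0 bf fF].
    apply: le_trans (var_le _ _ _ kn (lexx 0) bf f0) _.
    by rewrite expr0n/= !mulr0.
  have bFf := bounded_measurableZ F^-1 bf.
  have kn1 : (k < n.+1)%N by [].
  have := @eps_ge (Ordinal kn1) (fun x => F^-1 * f x).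
  rewrite eE lee_fin (varianceZ hg hxi)//= => H.
  rewrite -ler_pdivrMr ?exprn_gt0// mulrC -exprVn; apply: H; split=> //.
  rewrite Lnorm_le//= expr1n; under eq_Rintegral do rewrite exprMn.
  rewrite meanZ; last exact: bounded_measurableX.
  by rewrite exprVn ler_pdivrMl ?exprn_gt0// mulr1.
set A := 1 + _; set B := n%:R * _ * _ * _.
have main k (F : R) (f : borel E -> R) : (k <= n)%N -> 0 <= F ->
    bounded_measurable f -> \int[mu k]_x (f x ^+ (2 ^ s)) <= F ^+ (2 ^ s) ->
    N%:R * variance mu g K t P xi k f <= F ^+ 2 * (A + B * e).
  move=> kn F0 bf fF.
  apply: le_trans (variance_norm_le hg hg0 hmu hK hN hxi hgbar gamma1 tau0 tau1
    s0 delta_ge0 delta_le K_gap K_hyper e0 var_e kn F0 bf fF) _.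
  have kn' : k%:R <= n%:R :> R by rewrite ler_nat.
  (* The constants of [variance_norm_le] are now enlarged to those of the claim, using [k <= n],
     [tau <= 1], [gamma >= 1] and a maximum of at least [1]. *)
  have tau2 : tau^-1 <= tau ^- 2.
    by rewrite -exprVn -[leLHS]expr1 ler_weXn2l// invf_ge1.
  have tau2_ge0 : 0 <= tau ^- 2 by rewrite invr_ge0 exprn_ge0// ltW.
  apply: ler_wpM2l; first exact: sqr_ge0.
  apply: lerD; first apply: lerD => //.
    apply: ler_pM => //; first by rewrite mulr_ge0// ltW.
      by rewrite invr_ge0 ltW.
    by rewrite ler_wpM2r// ltW.
  apply: ler_wpM2r => //; rewrite /B -!mulrA; apply: ler_pM => //.
    by rewrite mulr_ge0// exprn_ge0// ltW.
  rewrite mulrA ler_wpM2r//.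
  have max1 : 1 <= Num.max (1 + gamma) 3 by rewrite le_max ler1n orbT.
  apply: (@le_trans _ _ (gamma `^ (2 * s%:R + p^-1))).
    rewrite -powR_mulrn ?(ltW gamma0)// natrM ler_powR//.
    by rewrite lerDl invr_ge0 (le_trans _ (ltW p2)).
  by rewrite ler_peMl// powR_ge0.
have N0 : 0 < N%:R :> R by rewrite ltr0n.
split=> [f bf|NB].
  pose F := (\int[mu n]_x (f x ^+ (2 ^ s))) `^ p^-1.
  have NF : 'N[mu n]_p%:E[EFin \o f]%E = F%:E.
    by rewrite /F pE; exact: Lnorm_even.
  have F0 : 0 <= F by exact: powR_ge0.
  rewrite mseE// NF eE.
  have := main n F f (leqnn n) F0 bf; rewrite -Lnorm_le// NF => /(_ (lexx _)) H.
  by rewrite -lee_fin in H.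
rewrite eE lee_fin.
(* The bound [main] with [F = 1] holds on every unit ball, so it passes to the supremum. *)
have : e <= (A + B * e) / N%:R.
  rewrite -lee_fin -eE; apply: eps_le => j f [bf f1].
  have := main j 1 f; rewrite !expr1n mul1r ler_pdivlMr// mulrC; apply=> //.
    by rewrite -ltnS.
  by have := Lnorm_le j f 1 bf ler01; rewrite expr1n => <-.
rewrite ler_pdivlMr// mulrA ler_pdivlMr// => eN.
(* Since [2 B <= N] and [e] is finite, [B e] is at most half of [N e] and is absorbed. *)
have : 2 * B * e <= N%:R * e.
  rewrite ler_wpM2r//; apply: le_trans NB; rewrite /B le_eqVlt; apply/orP; left.
  by apply/eqP; ring.
lra.
Qed.
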